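(* Let $(R,\mathfrak{m},k)$ be a complete Cohen-Macaulay local ring of dimension $d$ with canonical module $\Omega$. Then $\mathrm{Hom}_R(-,\Omega)$ is an endofunctor on $\mathrm{CohCM}(R)$ (that is, $\mathrm{Hom}_R(M,\Omega)\in\mathrm{CohCM}(R)$ for every $M\in\mathrm{CohCM}(R)$), and $\Omega$ is an injective object in $\mathrm{CohCM}(R)$.
   Context: Cohen-Macaulay local rings are commutative and Noetherian. $\mathrm{CohCM}(R)$ is the class of all (not necessarily finitely generated) $R$-modules $M$ with $\mathrm{Ext}_R^i(k,M)=0$ for all $i<d=\dim R$. The canonical module $\Omega$ is the (unique up to isomorphism) finitely generated maximal Cohen-Macaulay module with $\dim_k\mathrm{Ext}_R^i(k,\Omega)=0$ for $i\ne d$ and $=1$ for $i=d$; it exists since $R$ is complete. ''Injective object'' is with respect to the exact structure inherited from all $R$-modules: for every short exact sequence $0\to L\to M\to N\to 0$ of $R$-modules with $L,M,N\in\mathrm{CohCM}(R)$, the map $\mathrm{Hom}_R(M,\Omega)\to\mathrm{Hom}_R(L,\Omega)$ is surjective. *)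

(* Defs.v *)
From HB Require Import structures.
From mathcomp Require Import all_boot all_order all_algebra.
From mathcomp Require Import generic_quotient ring_quotient.
From mathcomp Require Import boolp finmap monalg.
Set Implicit Arguments.
Unset Strict Implicit.
Unset Printing Implicit Defensive.
Import GRing.Theory.
Local Open Scope ring_scope.
Local Open Scope quotient_scope.

Section Submodules.
Variables (R : comNzRingType) (V : lmodType R).

Record submod (S : submodClosed V) :=
  Submod { submod_val : V; submod_valP : submod_val \in S }.

Variable S : submodClosed V.
HB.instance Definition _ := [isSub for @submod_val S].
HB.instance Definition _ := [Choice of submod S by <:].
HB.instance Definition _ := [SubChoice_isSubLmodule of submod S by <:].

End Submodules.

Section Quotients.
Variables (R : comNzRingType) (V : lmodType R) (S : submodClosed V).

(* [submodClosed] does not inherit from [zmodClosed], on which the library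
   quotient is built, so the predicate is repackaged. *)
Definition zmod_of_submod : zmodClosed V :=
  HB.pack (fun v : V => v \in S)
    (GRing.isZmodClosed.Build V (fun v => v \in S)
      (GRing.submod_closedB (GRing.submodClosedP S))).

Definition quotmod := {ideal_quot zmod_of_submod}.
HB.instance Definition _ := GRing.Zmodule.on quotmod.
HB.instance Definition _ := Quotient.on quotmod.

Definition quotmod_scale (r : R) (x : quotmod) : quotmod :=
  \pi_quotmod (r *: repr x).

Lemma quotmod_piP (u v : V) :
  (\pi_quotmod u == \pi_quotmod v) = (u - v \in S).
Proof. by rewrite -[LHS]Quotient.idealrBE. Qed.

Lemma quotmod_scaleE r (v : V) :
  quotmod_scale r (\pi_quotmod v) = \pi_quotmod (r *: v).
Proof.
apply/eqP; rewrite quotmod_piP -scalerBr.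
apply: rpredZ.
by rewrite -quotmod_piP reprK eqxx.
Qed.

Lemma quotmod_piD (u v : V) :
  \pi_quotmod (u + v) = \pi_quotmod u + \pi_quotmod v.
Proof. exact: (@pi_addr _ _ _ _ _ {ideal_quot zmod_of_submod}). Qed.

Fact quotmod_scaleA a b v :
  quotmod_scale a (quotmod_scale b v) = quotmod_scale (a * b) v.
Proof.
by elim/quotW: v => v; rewrite (quotmod_scaleE b v) !quotmod_scaleE scalerA.
Qed.

Fact quotmod_scale1 : left_id 1 quotmod_scale.
Proof. by elim/quotW=> v; rewrite quotmod_scaleE scale1r. Qed.

Fact quotmod_scaleDr : right_distributive quotmod_scale +%R.
Proof.
move=> a; elim/quotW=> u; elim/quotW=> v; rewrite -quotmod_piD.
by rewrite !quotmod_scaleE scalerDr quotmod_piD.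
Qed.

Fact quotmod_scaleDl v : {morph quotmod_scale^~ v : a b / a + b}.
Proof.
by elim/quotW: v => v a b; rewrite !quotmod_scaleE scalerDl quotmod_piD.
Qed.

HB.instance Definition _ := GRing.Zmodule_isLmodule.Build R quotmod
  quotmod_scaleA quotmod_scale1 quotmod_scaleDr quotmod_scaleDl.

End Quotients.

Section KernelImage.
Variables (R : comNzRingType) (U V : lmodType R) (f : {linear U -> V}).

Fact ker_submod : submod_closed (fun u => f u == 0).
Proof.
split=> [|a u v]; rewrite !unfold_in ?linear0 // => /eqP fu /eqP fv.
by rewrite linearP fu fv scaler0 addr0.
Qed.
Definition ker : submodClosed U :=
  HB.pack (fun u => f u == 0) (GRing.isSubmodClosed.Build R U _ ker_submod).

Fact im_submod : submod_closed (fun y => `[< exists x, y = f x >]).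
Proof.
split=> [|a u v]; rewrite !unfold_in.
  by apply/asboolP; exists 0; rewrite linear0.
move=> /asboolP [x ->] /asboolP [y ->].
by apply/asboolP; exists (a *: x + y); rewrite linearP.
Qed.
Definition im : submodClosed V :=
  HB.pack (fun y => `[< exists x, y = f x >])
    (GRing.isSubmodClosed.Build R V _ im_submod).

End KernelImage.

Section Homology.
Variables (R : comNzRingType) (A B C : lmodType R).
Variables (f : {linear A -> B}) (g : {linear B -> C}).

Fact bound_submod : submod_closed (fun z : submod (ker g) => val z \in im f).
Proof.
split=> [|a u v fu fv]; first exact: (rpred0 (im f)).
exact: (rpredD (rpredZ a fu : a *: val u \in im f) fv).
Qed.
Definition bound : submodClosed (submod (ker g)) :=
  HB.pack (fun z : submod (ker g) => val z \in im f)
    (GRing.isSubmodClosed.Build R _ _ bound_submod).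

(* ker g / im f, for A --f--> B --g--> C *)
Definition homology : lmodType R := quotmod bound.

End Homology.

Section HomModule.
Variables (R : comNzRingType) (U V : lmodType R).

Definition HomMod := {linear U -> V}.
HB.instance Definition _ := gen_eqMixin HomMod.
HB.instance Definition _ := gen_choiceMixin HomMod.

Implicit Types f g h : HomMod.

Lemma HomP f g : f =1 g -> f = g.
Proof.
case: f g => [f [[Af] [Bf]]] [g [[Ag] [Bg]]] /= /funext fg.
rewrite fg in Af Bf *; congr GRing.Linear.Pack.
congr GRing.Linear.Class; congr (_ _); [|exact: Prop_irrelevance].
by case: Af Ag => [Af1 Af2] [Ag1 Ag2]; congr pair; exact: Prop_irrelevance.
Qed.

Definition Hom0 : HomMod := \0.
Definition HomD f g : HomMod := f \+ g.
Definition HomN f : HomMod := \- f.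

Fact HomZ_linear (a : R) f : linear (fun u => a *: f u).
Proof.
by move=> b u v; rewrite linearP scalerDr !scalerA mulrC.
Qed.
Definition HomZ (a : R) f : HomMod :=
  HB.pack (fun u => a *: f u) (GRing.isLinear.Build R U V _ _ (HomZ_linear a f)).

Fact HomDA : associative HomD.
Proof. by move=> f g h; apply: HomP => u /=; rewrite addrA. Qed.
Fact HomDC : commutative HomD.
Proof. by move=> f g; apply: HomP => u /=; rewrite addrC. Qed.
Fact Hom0D : left_id Hom0 HomD.
Proof. by move=> f; apply: HomP => u /=; rewrite add0r. Qed.
Fact HomND : left_inverse Hom0 HomN HomD.
Proof. by move=> f; apply: HomP => u /=; rewrite addNr. Qed.
HB.instance Definition _ := GRing.isZmodule.Build HomMod HomDA HomDC Hom0D HomND.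

Fact HomZA a b f : HomZ a (HomZ b f) = HomZ (a * b) f.
Proof. by apply: HomP => u /=; rewrite scalerA. Qed.
Fact HomZ1 : left_id 1 HomZ.
Proof. by move=> f; apply: HomP => u /=; rewrite scale1r. Qed.
Fact HomZDr : right_distributive HomZ +%R.
Proof. by move=> a f g; apply: HomP => u /=; rewrite scalerDr. Qed.
Fact HomZDl f : {morph HomZ^~ f : a b / a + b}.
Proof. by move=> a b; apply: HomP => u /=; rewrite scalerDl. Qed.
HB.instance Definition _ :=
  GRing.Zmodule_isLmodule.Build R HomMod HomZA HomZ1 HomZDr HomZDl.

End HomModule.

Section Precomp.
Variables (R : comNzRingType) (U V W : lmodType R) (f : {linear U -> V}).

Definition precomp_fun (g : HomMod V W) : HomMod U W := g \o f.
Fact precomp_linear : linear precomp_fun.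
Proof. by move=> a g h; apply: HomP. Qed.

(* the map Hom(f, W), from Hom(V, W) to Hom(U, W) *)
Definition precomp : {linear HomMod V W -> HomMod U W} :=
  HB.pack precomp_fun
    (GRing.isLinear.Build R (HomMod V W) (HomMod U W) _ _ precomp_linear).

End Precomp.

Section FreeResolution.
Variable R : comNzRingType.

(* {malg R[N]} is used only as the free R-module on the set N. *)
Definition aug_fun (N : lmodType R) (g : {malg R[N]}) : N :=
  \sum_(x <- msupp g) g@_x *: x.

Lemma aug_funEw (N : lmodType R) (g : {malg R[N]}) (D : {fset N}) :
  (msupp g `<=` D)%fset -> aug_fun g = \sum_(x <- D) g@_x *: x.
Proof.
move=> gD; rewrite [RHS](big_fsetID _ (mem (msupp g))) /=.
rewrite [X in _ + X]big1_fset ?addr0 => [|x]; last first.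
  by rewrite !inE => /andP[_ /mcoeff_outdom ->] _; rewrite scale0r.
apply: eq_fbigl => x; rewrite !inE; apply/idP/andP => [xg|[]//].
by split=> //; apply: (fsubsetP gD).
Qed.

Fact aug_linear (N : lmodType R) : linear (@aug_fun N).
Proof.
move=> a g h; pose D := (msupp (a *: g + h) `|` msupp g `|` msupp h)%fset.
rewrite !(@aug_funEw N _ D);
  try by apply/fsubsetP => x; rewrite !inE => ->; rewrite ?orbT.
rewrite scaler_sumr -big_split /=; apply: eq_bigr => x _.
by rewrite mcoeffD mcoeffZ scalerDl scalerA.
Qed.

(* the canonical surjection from the free module on the set N onto N *)
Definition aug (N : lmodType R) : {linear {malg R[N]} -> N} :=
  HB.pack (@aug_fun N) (GRing.isLinear.Build R {malg R[N]} N _ _ (@aug_linear N)).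

(* syz N 0 = N and syz N i.+1 = ker (res N i -> syz N i): the free modules
   res N i form a free resolution of N. *)
Definition syz (N : lmodType R) (i : nat) : lmodType R :=
  iter i (fun K : lmodType R => submod (ker (aug K)) : lmodType R) N.

Definition res (N : lmodType R) (i : nat) : lmodType R := {malg R[syz N i]}.

Definition dres (N : lmodType R) (i : nat) : {linear res N i.+1 -> res N i} :=
  (val : {linear submod (ker (aug (syz N i))) -> res N i}) \o aug (syz N i.+1).

Lemma aug_surj (N : lmodType R) (x : N) : aug N << x >>%R = x.
Proof.
rewrite /= (@aug_funEw N _ [fset x]%fset) ?msuppU_le //.
by rewrite big_seq_fset1 mcoeffUU scale1r.
Qed.

Lemma dres_exact (N : lmodType R) (i : nat) (y : res N i.+1) :
  dres N i y = 0 <-> exists x, y = dres N i.+1 x.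
Proof.
split=> [dy0|[x ->]] /=.
  have yker : y \in ker (aug (syz N i.+1)).
    by apply/eqP/val_inj; rewrite -[LHS]/(dres N i y) dy0 linear0.
  by exists (<< Submod yker >>)%R; rewrite -[RHS]/(val (aug _ _)) aug_surj.
have /eqP aug0 := valP (aug (syz N i.+2) x).
exact: (congr1 val aug0).
Qed.

Definition Ext (i : nat) (N M : lmodType R) : lmodType R :=
  let delta j : {linear HomMod (res N j) M -> HomMod (res N j.+1) M} :=
    precomp M (dres N j) in
  match i with
  | 0 => homology
      (\0 : {linear HomMod (res N 0) M -> HomMod (res N 0) M}) (delta 0)
  | j.+1 => homology (delta j) (delta j.+1)
  end.

End FreeResolution.

Section ResidueField.
Variables (R : comNzRingType) (m : idealr R).

Definition residue := {ideal_quot m}.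
HB.instance Definition _ := GRing.ComNzRing.on residue.
HB.instance Definition _ := Quotient.on residue.

Definition residue_scale (r : R) (x : residue) : residue :=
  \pi_{ideal_quot m} r * x.

Fact residue_scaleA a b x :
  residue_scale a (residue_scale b x) = residue_scale (a * b) x.
Proof. by rewrite /residue_scale mulrA -rmorphM. Qed.
Fact residue_scale1 : left_id 1 residue_scale.
Proof. by move=> x; rewrite /residue_scale rmorph1 mul1r. Qed.
Fact residue_scaleDr : right_distributive residue_scale +%R.
Proof. by move=> a x y; rewrite /residue_scale mulrDr. Qed.
Fact residue_scaleDl x : {morph residue_scale^~ x : a b / a + b}.
Proof. by move=> a b; rewrite /residue_scale rmorphD mulrDl. Qed.
HB.instance Definition _ := GRing.Zmodule_isLmodule.Build R residue
  residue_scaleA residue_scale1 residue_scaleDr residue_scaleDl.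

(* V is annihilated by m, hence a vector space over k = R/m on which a class
   acts through any representative, and it has a k-basis with n elements. *)
Definition kdim (V : lmodType R) (n : nat) : Prop :=
  (forall r (v : V), r \in m -> r *: v = 0) /\
  exists e : 'I_n -> V, forall v : V,
    exists! c : {ffun 'I_n -> residue}, v = \sum_(i < n) repr (c i) *: e i.

End ResidueField.

Section CommutativeAlgebra.
Variable R : comNzRingType.

Definition fin_gen (M : lmodType R) : Prop :=
  exists s : seq M, forall v : M,
    exists c : nat -> R, v = \sum_(i < size s) c i *: s`_i.

Definition noetherian : Prop := forall I : submodClosed R^o, fin_gen (submod I).

(* elements of [idealr R] are proper ideals *)
Definition maximal_ideal (m : idealr R) : Prop :=
  forall I : idealr R, {subset m <= I} -> {subset I <= m}.

Definition local_ring (m : idealr R) : Prop :=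
  maximal_ideal m /\ forall n : idealr R, maximal_ideal n -> n =i m.

Definition prime_chain (n : nat) (p : nat -> prime_idealr R) : Prop :=
  forall i, (i < n)%N -> {subset p i <= p i.+1} /\ ~ {subset p i.+1 <= p i}.

Definition krull_dim (d : nat) : Prop :=
  (exists p, prime_chain d p) /\
  forall n p, prime_chain n p -> (n <= d)%N.

Fixpoint ideal_pow (I : idealr R) (n : nat) (x : R) : Prop :=
  match n with
  | 0 => True
  | k.+1 => exists s : seq (R * R),
      (forall p, p \in s -> p.1 \in I /\ ideal_pow I k p.2) /\
      x = \sum_(p <- s) p.1 * p.2
  end.

(* R -> lim R/I^n is bijective; u is a sequence of lifts of a compatible
   family of classes. *)
Definition adically_complete (I : idealr R) : Prop :=
  forall u : nat -> R, (forall n, ideal_pow I n (u n.+1 - u n)) ->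
    exists! x : R, forall n, ideal_pow I n (x - u n).

(* v belongs to (s_0, ..., s_{l-1}) M *)
Definition in_seqM (M : lmodType R) (s : seq R) (v : M) : Prop :=
  exists w : nat -> M, v = \sum_(i < size s) s`_i *: w i.

Definition regular_seq (M : lmodType R) (s : seq R) : Prop :=
  (forall i, (i < size s)%N -> forall v : M,
     in_seqM (take i s) (s`_i *: v) -> in_seqM (take i s) v) /\
  ~ (forall v : M, in_seqM s v).

Definition depth (m : idealr R) (M : lmodType R) (n : nat) : Prop :=
  (exists s, [/\ {subset s <= m}, regular_seq M s & size s = n]) /\
  forall s, {subset s <= m} -> regular_seq M s -> (size s <= n)%N.

Definition short_exact (L M N : lmodType R)
    (f : {linear L -> M}) (g : {linear M -> N}) : Prop :=
  [/\ injective f, forall y, g y = 0 <-> exists x, y = f x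
    & forall z, exists y, z = g y].

(* injective object of a class C of modules, for the exact structure inherited
   from all modules *)
Definition injective_object (C : lmodType R -> Prop) (I : lmodType R) : Prop :=
  C I /\
  forall (L M N : lmodType R) (f : {linear L -> M}) (g : {linear M -> N}),
    C L -> C M -> C N -> short_exact f g ->
    forall phi : HomMod L I, exists psi : HomMod M I, precomp I f psi = phi.

End CommutativeAlgebra.

Section CohenMacaulay.
(* In this section m is the maximal ideal and d the dimension of R. *)
Variables (R : comNzRingType) (m : idealr R) (d : nat).

Definition CM_ring : Prop := depth m R^o d.

Definition CohCM (M : lmodType R) : Prop :=
  forall i, (i < d)%N -> forall x : Ext i (residue m) M, x = 0.

Definition max_CM (M : lmodType R) : Prop := fin_gen M /\ depth m M d.

(* the dimension (i == d : nat) is 1 for i = d and 0 otherwise *)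
Definition canonical_module (Omega : lmodType R) : Prop :=
  max_CM Omega /\
  forall i, kdim m (Ext i (residue m) Omega) (i == d : nat).

End CohenMacaulay.

(* Main.v *)
Require Import Defs.
From HB Require Import structures.
From mathcomp Require Import all_boot all_order all_algebra ring.
From mathcomp Require Import generic_quotient ring_quotient.
From mathcomp Require Import boolp classical_sets functions finmap monalg.

(* A regular sequence s of length d on R generates an m-primary ideal, since
   d = dim R. If M is in CohCM, its Koszul complex on s is exact below the top
   degree: its first nonzero cohomology would have a nonzero socle. In
   particular K/sK -> F/sF is injective for 0 -> K -> F -> M -> 0 with F free,
   and s is regular on Omega by rigidity. On the other hand J = Omega/s Omega is
   injective over R/(s): it is the submodule killed by s of the iterated local
   cohomology module E = H^d_s(Omega), and
   Ext^1 (k, E) = Ext^(d+1) (k, Omega) = 0. So every map K -> J extends to F,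
   i.e. Ext^1 (M, J) = 0. Removing the elements of s one at a time, completeness
   lifts this to Ext^1 (M, Omega) = 0, which is the injectivity of Omega, and
   also shows that s is a regular sequence on Hom (M, Omega), whence the
   vanishing of Ext^i (k, Hom (M, Omega)) for i < d. *)

Set Implicit Arguments.
Unset Strict Implicit.
Unset Printing Implicit Defensive.
Import GRing.Theory.
Local Open Scope ring_scope.

#[local] Opaque aug.

(** A module in [CohCM] need not be finitely generated, and s need not be regular on it: for a prime
    p other than m, the residue field of R_p lies in [CohCM], since an element of m outside p acts
    bijectively on it, yet every element of s in p annihilates it. Hence the hypothesis on M is used
    only through the exactness of its Koszul complex, and Ext^1 (M, J) is treated by extending maps
    along K/sK -> F/sF instead of passing to M/sM. Injectivity of J over R/(s) can be tested on m
    alone: as (s) is m-primary, above every proper submodule of F containing sF there is an element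
    outside it that m carries into it. All Ext computations stay with the one free resolution in the
    definition of [Ext]; the exact sequences are chased with maps out of its syzygies. *)

Section LinearMaps.
Variable R : comNzRingType.
Implicit Types U V W : lmodType R.

Lemma linear_of_fun U V (f : U -> V) :
  linear f -> exists g : {linear U -> V}, g =1 f.
Proof.
move=> lf.
by exists (HB.pack_for {linear U -> V} f (GRing.isLinear.Build R U V _ f lf)).
Qed.

(** For maps obtained by choosing preimages, extensions or sums of series: the choice itself is
    arbitrary, and uniqueness of the value makes it linear. *)
Lemma linear_of_rel U V (G : U -> V -> Prop) :
  (forall u, exists v, G u v) -> (forall u v w, G u v -> G u w -> v = w) ->
  (forall a u v u' v', G u v -> G u' v' -> G (a *: u + u') (a *: v + v')) ->
  exists g : {linear U -> V}, forall u, G u (g u).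
Proof.
move=> /choice [f Gf] Gfun Glin.
have lf : linear f by move=> a u v; apply: Gfun (Gf _) _; apply: Glin.
by have [g gE] := linear_of_fun lf; exists g => u; rewrite gE.
Qed.

Lemma factor_surj U V W (p : {linear U -> V}) (f : {linear U -> W}) :
  (forall v, exists u, v = p u) -> (forall u, p u = 0 -> f u = 0) ->
  exists g : {linear V -> W}, forall u, g (p u) = f u.
Proof.
move=> psurj pf.
have fE u u' : p u = p u' -> f u = f u'.
  move=> puu'; apply/eqP; rewrite -subr_eq0 -linearB; apply/eqP/pf.
  by rewrite linearB puu' subrr.
have [|||g gP] := @linear_of_rel V W (fun v w => exists2 u, v = p u & w = f u).
- by move=> v; have [u ->] := psurj v; exists (f u); exists u.
- by move=> _ w w' [u -> ->] [u' /fE uu' ->].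
- move=> a _ _ _ _ [u -> ->] [u' -> ->].
  by exists (a *: u + u'); rewrite linearP.
by exists g => u; have [u' /fE -> ->] := gP (p u).
Qed.

Lemma factor_inj U V W (i : {linear W -> V}) (f : {linear U -> V}) :
  injective i -> (forall u, exists w, f u = i w) ->
  exists g : {linear U -> W}, forall u, i (g u) = f u.
Proof.
move=> iinj fi.
have [|||g gP] := @linear_of_rel U W (fun u w => f u = i w) => //.
- by move=> u v w -> /iinj.
- by move=> a u v u' v' fu fu'; rewrite !linearP fu fu'.
- by exists g => u; rewrite gP.
Qed.

Lemma inj_ker0 U V (f : {linear U -> V}) :
  (forall u, f u = 0 -> u = 0) -> injective f.
Proof.
move=> f0 u v fuv; apply/eqP; rewrite -subr_eq0; apply/eqP/f0.
by rewrite linearB fuv subrr.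
Qed.

Lemma malg_lift (N : choiceType) V W (g : {linear V -> W})
    (f : {linear {malg R[N]} -> W}) :
  (forall u, exists v, f u = g v) ->
  exists h : {linear {malg R[N]} -> V}, forall u, g (h u) = f u.
Proof.
move=> fg; have [b bP] := choice (fun x : N => fg << x >>%R).
(* The support varies with u; [hEw] moves the sum to a common finite set, on which linearity is
   checked. *)
pose h (u : {malg R[N]}) := \sum_(x <- msupp u) u@_x *: b x.
have hEw u (D : {fset N}) :
    (msupp u `<=` D)%fset -> h u = \sum_(x <- D) u@_x *: b x.
  move=> uD; rewrite [RHS](big_fsetID _ (mem (msupp u))) /=.
  rewrite [X in _ + X]big1_fset ?addr0 => [|x]; last first.
    by rewrite !inE => /andP[_ /mcoeff_outdom ->] _; rewrite scale0r.
  apply: eq_fbigl => x; rewrite !inE; apply/idP/andP => [xg|[]//].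
  by split=> //; apply: (fsubsetP uD).
have hlin : linear h.
  move=> a u v; pose D := (msupp (a *: u + v) `|` msupp u `|` msupp v)%fset.
  rewrite !(hEw _ D);
    try by apply/fsubsetP => x; rewrite !inE => ->; rewrite ?orbT.
  rewrite scaler_sumr -big_split /=; apply: eq_bigr => x _.
  by rewrite mcoeffD mcoeffZ scalerDl scalerA.
have [h' hE] := linear_of_fun hlin; exists h' => u.
rewrite hE [in RHS](monalgE u) !linear_sum; apply: eq_bigr => x _.
rewrite linearZ -bP -linearZ; congr (f _).
by apply/malgP => y; rewrite mcoeffZ !mcoeffU mulrnAr mulr1.
Qed.

End LinearMaps.

Section Quotient.
Variables (R : comNzRingType) (V : lmodType R) (S : submodClosed V).

Fact quotmod_pi_linear : linear (\pi_(quotmod S) : V -> quotmod S)%qT.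
Proof.
by move=> a u v; rewrite quotmod_piD -(quotmod_scaleE S a u).
Qed.
Definition quo : {linear V -> quotmod S} :=
  HB.pack_for {linear V -> quotmod S} (\pi_(quotmod S) : V -> quotmod S)%qT
    (GRing.isLinear.Build R V (quotmod S) _ _ quotmod_pi_linear).

Lemma quo_eq0 v : quo v = 0 <-> v \in S.
Proof.
have := quotmod_piP S v 0; rewrite subr0 => <-.
by rewrite -[X in X <-> _]/(quo v = 0) -(linear0 quo); split=> /eqP.
Qed.

Lemma quo_surj x : exists v, x = quo v.
Proof. by exists (repr x); rewrite /quo /= reprK. Qed.

End Quotient.
#[local] Opaque quo.


(** * Vanishing of Ext in terms of syzygies *)

Section Presentation.
Variable R : comNzRingType.
Implicit Types N Q V W : lmodType R.

(** [syz (syz N j) 1] and [syz N j.+1] are convertible, so this one presentation serves at every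
    step of the resolution. *)
Definition incl N : {linear syz N 1 -> res N 0} :=
  (val : {linear submod (ker (aug N)) -> res N 0}).


Lemma incl_inj N : injective (incl N).
Proof. exact: val_inj. Qed.

Lemma aug_incl N u : aug N (incl N u) = 0.
Proof. by have /eqP := valP u. Qed.

Lemma aug_ker N w : aug N w = 0 -> exists u, w = incl N u.
Proof.
move=> /eqP w0; have wK : w \in ker (aug N) by [].
by exists (Submod wK).
Qed.

Lemma aug_onto N (x : N) : exists w, x = aug N w.
Proof. by exists << x >>%R; rewrite aug_surj. Qed.

Lemma res_lift N V W (g : {linear V -> W}) (f : {linear res N 0 -> W}) :
  (forall u, exists v, f u = g v) ->
  exists h : {linear res N 0 -> V}, forall u, g (h u) = f u.
Proof. exact: malg_lift. Qed.

(* [Ext^1 (N, Q) = 0] *)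
Definition ext1_vanish N Q : Prop :=
  forall phi : {linear syz N 1 -> Q}, exists psi : {linear res N 0 -> Q},
    forall u, psi (incl N u) = phi u.

(** Dimension shifting, taken as the definition. *)
Definition ext_vanish (i : nat) N Q : Prop :=
  match i with
  | 0 => forall phi : {linear N -> Q}, forall u, phi u = 0
  | j.+1 => ext1_vanish (syz N j) Q
  end.

End Presentation.
#[local] Opaque incl.

Section ExtBridge.
Variable R : comNzRingType.
Implicit Types N Q : lmodType R.

Lemma homology_zero (A B C : lmodType R) (f : {linear A -> B})
    (g : {linear B -> C}) :
  (forall x : homology f g, x = 0) <->
  (forall y, g y = 0 -> exists x, y = f x).
Proof.
split=> [H y gy|H x].
  have yK : y \in ker g by apply/eqP.
  have /quo_eq0 /asboolP [x yx] := H (quo (bound f g) (Submod yK)).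
  by exists x.
have [v ->] := quo_surj x; apply/quo_eq0.
have /eqP gv := valP v; have [y vy] := H _ gv.
by apply/asboolP; exists y.
Qed.

(** A cochain on [res N j.+1] is a cocycle exactly when it factors through [aug] as a map out of
    [syz N j.+1], and a coboundary exactly when that map extends to [res N j]. In degree 0 cocycles
    are maps out of N. *)
Lemma ext_vanishE i N Q :
  ext_vanish i N Q <-> (forall x : Ext i N Q, x = 0).
Proof.
have resE j (u : res N j.+1) : dres N j u = incl (syz N j) (aug (syz N j.+1) u).
  by [].
case: i => [|i]; rewrite /Ext homology_zero; split=> H.
- move=> y dy0; exists 0; apply: HomP => u.
  have [||phi phiE] := @factor_surj _ _ _ _ (aug N) y.
  + exact: aug_onto.
  + move=> _ /aug_ker [k ->]; have [w ->] := aug_onto k.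
    exact: (congr1 (fun h : HomMod _ _ => h w) dy0).
  by rewrite -phiE H.
- move=> phi u; have [w ->] := aug_onto u.
  have [|x xE] := H (phi \o aug N).
    apply: HomP => v.
    transitivity (phi 0); last exact: linear0.
    exact: (congr1 phi (aug_incl (aug (syz N 1) v))).
  exact: (congr1 (fun h : HomMod _ _ => h w) xE).
- move=> y dy0.
  have [||phi phiE] := @factor_surj _ _ _ _ (aug (syz N i.+1)) y.
  + exact: aug_onto.
  + move=> _ /aug_ker [k ->]; have [w ->] := aug_onto k.
    exact: (congr1 (fun h : HomMod _ _ => h w) dy0).
  have [psi psiE] := H phi; exists psi; apply: HomP => u.
  by rewrite -phiE -psiE.
- move=> phi; have [|psi psiE] := H (phi \o aug (syz N i.+1)).
    apply: HomP => v; transitivity (phi 0); last exact: linear0.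
    exact: (congr1 phi (aug_incl (aug (syz N i.+2) v))).
  exists psi => u; have [w ->] := aug_onto u.
  exact: (esym (congr1 (fun h : HomMod _ _ => h w) psiE)).
Qed.

End ExtBridge.

(** * Long exact sequences of Ext in the second variable *)

Section LongExact.
Variable R : comNzRingType.
Variables (Q' Q Q'' : lmodType R).
Variables (f : {linear Q' -> Q}) (g : {linear Q -> Q''}).
Hypothesis fg : short_exact f g.
Implicit Type N : lmodType R.

(** Lift [phi \o aug N] to the free cover. On syzygies the lift lands in Q'; extending that part to
    the free module and subtracting it lets the lift descend to N. *)
Lemma ext1_lift N (phi : {linear N -> Q''}) :
  ext1_vanish N Q' -> exists phi' : {linear N -> Q}, forall u, g (phi' u) = phi u.
Proof.
case: fg => finj exact_fg gsurj EN.
have [h hE] := @res_lift _ N _ _ g (phi \o aug N) (fun u => gsurj _).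
have [|k kE] := @factor_inj _ _ _ _ f (h \o incl N) finj.
  by move=> u; apply/exact_fg; rewrite /= hE /= aug_incl linear0.
have [k' k'E] := EN k.
have [||phi' phi'E] := @factor_surj _ _ _ _ (aug N) (h \- (f \o k')).
- exact: aug_onto.
- by move=> _ /aug_ker [u ->] /=; rewrite k'E kE /= subrr.
exists phi' => u; have [w ->] := aug_onto u.
rewrite phi'E /= linearB hE; suff -> : g (f (k' w)) = 0 by rewrite subr0.
by apply/exact_fg; exists (k' w).
Qed.

Lemma ext_vanish_coker N i :
  ext_vanish i N Q -> ext_vanish i.+1 N Q' -> ext_vanish i N Q''.
Proof.
case: i => [|i] EQ EQ' phi; have [phi' phi'E] := ext1_lift phi EQ'.
  by move=> u; rewrite -phi'E EQ linear0.
have [psi psiE] := EQ phi'.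
by exists (g \o psi) => u /=; rewrite psiE phi'E.
Qed.

(** A class of Ext^(i+1) (N, Q') that dies in Ext^(i+1) (N, Q) comes from Ext^i (N, Q''). *)
Lemma ext_extend_ker N i (phi : {linear syz N i.+1 -> Q'})
    (psi : {linear res (syz N i) 0 -> Q}) :
  (forall u, psi (incl (syz N i) u) = f (phi u)) -> ext_vanish i N Q'' ->
  exists psi' : {linear res (syz N i) 0 -> Q'},
    forall u, psi' (incl (syz N i) u) = phi u.
Proof.
case: fg => finj exact_fg gsurj psiE EQ.
have gf u : g (f u) = 0 by apply/exact_fg; exists u.
have [||chi chiE] := @factor_surj _ _ _ _ (aug (syz N i)) (g \o psi).
- exact: aug_onto.
- by move=> _ /aug_ker [u ->] /=; rewrite psiE gf.
(* [chi] represents the class in Ext^i (N, Q''). Being zero, it extends to a free module when i > 0,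
   and from there lifts through g. *)
have [theta thetaE] : exists theta : {linear syz N i -> Q},
    forall u, g (theta u) = chi u.
  case: i phi psi psiE EQ chi chiE => [|i] phi psi psiE EQ chi chiE.
    by exists \0 => u; rewrite EQ /= linear0.
  have [chi' chi'E] := EQ chi.
  have [h hE] := res_lift (fun u => gsurj (chi' u)).
  by exists (h \o incl (syz N i)) => u; rewrite /= hE chi'E.
have [|psi' psi'E] := @factor_inj _ _ _ _ f (psi \- (theta \o aug (syz N i))) finj.
  by move=> u; apply/exact_fg; rewrite /= linearB thetaE chiE subrr.
exists psi' => u; apply: finj; rewrite psi'E /= psiE.
have -> : theta (aug (syz N i) (incl (syz N i) u)) = theta 0.
  exact: (congr1 theta (aug_incl u)).
by rewrite linear0 subr0.
Qed.

End LongExact.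

Lemma imP (R : comNzRingType) (U V : lmodType R) (f : {linear U -> V}) y :
  y \in im f <-> exists x, y = f x.
Proof. by split=> /asboolP. Qed.

(** * Multiplication by an element, and Ext of modules that it kills *)

Section Multiplication.
Variables (R : comNzRingType) (x : R).
Implicit Types N Q : lmodType R.

Definition mulm Q : {linear Q -> Q} := *:%R x.
Definition modm Q : lmodType R := quotmod (im (mulm Q)).

Lemma mulmE Q (v : Q) : mulm Q v = x *: v.
Proof. by []. Qed.

Definition quom Q : {linear Q -> modm Q} := quo (im (mulm Q)).

Lemma quom_eq0 Q v : quom Q v = 0 <-> exists w, v = x *: w.
Proof. by rewrite -imP; apply: quo_eq0. Qed.

Lemma quom_surj Q z : exists v, z = quom Q v.
Proof. exact: quo_surj. Qed.

Lemma modm_killed Q (v : modm Q) : x *: v = 0.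
Proof.
have [w ->] := quom_surj v; rewrite -linearZ.
by apply/quom_eq0; exists w.
Qed.

Lemma modm_exact Q :
  injective (mulm Q) -> short_exact (mulm Q) (quom Q).
Proof. by move=> xinj; split=> //; [exact: quom_eq0|exact: quom_surj]. Qed.

Section Killed.
Variable N : lmodType R.
Hypothesis xN : forall v : N, x *: v = 0.

(* Multiplication by x on the syzygies of N factors through a free module, which
   is why x annihilates the Ext modules of N. *)
Lemma mulm_syz_factor i :
  exists gamma : {linear res (syz N i) 0 -> syz N i.+1},
    forall u, gamma (incl (syz N i) u) = x *: u.
Proof.
elim: i => [|i [gamma gammaE]].
  have [|gamma gammaE] :=
    @factor_inj _ _ _ _ (incl N) (mulm (res N 0)) (@incl_inj _ N).
    by move=> w; apply: aug_ker; rewrite [LHS]linearZ; apply: xN.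
  exists gamma => u; apply: (@incl_inj _ N).
  by rewrite [LHS]gammaE mulmE linearZ.
(* [gamma'] is the next term of a null homotopy of multiplication by x. The correction it gives
   vanishes on syzygies, as [aug] does. *)
have [gamma' gamma'E] := res_lift (fun u => aug_onto (gamma u)).
have [|h hE] := @factor_inj _ _ _ _ (incl (syz N i.+1))
  (mulm (res (syz N i.+1) 0) \- (gamma' \o incl (syz N i) \o aug (syz N i.+1)))
  (@incl_inj _ _).
  move=> w; apply: aug_ker; rewrite linearB gamma'E /= linearZ.
  by rewrite gammaE subrr.
exists h => u; apply: (@incl_inj _ (syz N i.+1)); rewrite hE /=.
have -> : aug (syz N i.+1) (incl (syz N i.+1) u) = 0 by exact: aug_incl.
by rewrite !linear0 addr0 linearZ.
Qed.

Lemma mulm_extend i Q (phi : {linear syz N i.+1 -> Q}) :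
  exists psi : {linear res (syz N i) 0 -> Q},
    forall u, psi (incl (syz N i) u) = x *: phi u.
Proof.
have [gamma gammaE] := mulm_syz_factor i.
by exists (phi \o gamma) => u /=; rewrite gammaE linearZ.
Qed.

Lemma ext_vanish0_inj Q : injective (mulm Q) -> ext_vanish 0 N Q.
Proof.
move=> xinj phi u; apply: xinj.
by rewrite !mulmE -linearZ xN !linear0.
Qed.

(** Multiplication by x is zero on Ext^(i+1) (N, Q), so the connecting map from Ext^i (N, Q'') is
    onto. *)
Lemma ext_vanish_mod i Q Q'' (g : {linear Q -> Q''}) :
  short_exact (mulm Q) g -> ext_vanish i N Q'' -> ext_vanish i.+1 N Q.
Proof.
move=> fg EQ phi; have [psi psiE] := mulm_extend phi.
exact: (ext_extend_ker fg psiE EQ).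
Qed.

(** On Ext^i (N, Q), x acts as zero through N and bijectively through Q. *)
Lemma ext_vanish_bij i Q :
  injective (mulm Q) -> (forall v : Q, exists w, v = x *: w) ->
  ext_vanish i N Q.
Proof.
move=> xinj xsurj; case: i => [|i phi]; first exact: ext_vanish0_inj.
have [psi psiE] := mulm_extend phi.
have [psi' psi'E] := @res_lift _ _ _ _ (mulm Q) psi (fun u => xsurj _).
by exists psi' => u; apply: xinj; rewrite psi'E psiE.
Qed.

End Killed.
End Multiplication.

Lemma residue_killed (R : comNzRingType) (m : idealr R) (x : R) :
  x \in m -> forall v : residue m, x *: v = 0.
Proof.
move=> xm v; suff x0 : (\pi_({ideal_quot m}) x = 0)%qT.
  by rewrite -[LHS]/((\pi_({ideal_quot m}) x)%qT * v) x0 mul0r.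
have -> : 0 = (\pi_({ideal_quot m}) 0)%qT :> {ideal_quot m}.
  by rewrite -pi_zeror.
by apply/eqP; rewrite -Quotient.idealrBE subr0.
Qed.

(** * Regular sequences and systems of parameters *)

Section Multiples.
Variables (R : comNzRingType) (M : lmodType R).
Implicit Types (s t : seq R) (v : M).

Lemma in_seqM_nil v : in_seqM [::] v <-> v = 0.
Proof.
by split=> [[w ->]|->]; [rewrite big_ord0|exists (fun=> 0); rewrite big_ord0].
Qed.

Lemma in_seqM_cons x s v :
  in_seqM (x :: s) v <-> exists w v', in_seqM s v' /\ v = x *: w + v'.
Proof.
split=> [[w ->]|[w0 [_ [[w ->] ->]]]].
  exists (w 0), (\sum_(i < size s) s`_i *: w i.+1).
  by rewrite big_ord_recl; split=> //; exists (fun i => w i.+1).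
exists (fun i => if i is j.+1 then w j else w0).
by rewrite big_ord_recl.
Qed.

Lemma in_seqMP s a u v : in_seqM s u -> in_seqM s v -> in_seqM s (a *: u + v).
Proof.
move=> [w ->] [w' ->]; exists (fun i => a *: w i + w' i).
rewrite scaler_sumr -big_split; apply: eq_bigr => i _ /=.
by rewrite scalerDr !scalerA mulrC.
Qed.

Lemma in_seqM0 s : in_seqM s (0 : M).
Proof. by exists (fun=> 0); rewrite big1 // => i _; rewrite scaler0. Qed.

Lemma in_seqMD s u v : in_seqM s u -> in_seqM s v -> in_seqM s (u + v).
Proof. by move=> su sv; rewrite -[u]scale1r; apply: in_seqMP. Qed.

Lemma in_seqMZ s a v : in_seqM s v -> in_seqM s (a *: v).
Proof. by move=> sv; rewrite -[_ *: _]addr0; apply: in_seqMP (in_seqM0 s). Qed.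

Lemma in_seqM_mem s x v : x \in s -> in_seqM s (x *: v).
Proof.
elim: s => // y s IHs; rewrite inE => /orP [/eqP ->|/IHs sxv].
  apply/in_seqM_cons; exists v, 0; rewrite addr0; split=> //.
  exact: in_seqM0.
by apply/in_seqM_cons; exists 0, (x *: v); rewrite scaler0 add0r.
Qed.

Lemma in_seqM_sub s t v : {subset s <= t} -> in_seqM s v -> in_seqM t v.
Proof.
elim: s v => [|x s IHs] v st; first by move/in_seqM_nil->; apply: in_seqM0.
move=> /in_seqM_cons [w [v' [sv' ->]]]; apply: in_seqMD.
  by apply: in_seqM_mem; apply: st; rewrite mem_head.
by apply: IHs => // y ys; apply: st; rewrite inE ys orbT.
Qed.

End Multiples.

Lemma in_seqM_map (R : comNzRingType) (M N : lmodType R) (f : {linear M -> N}) s v :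
  in_seqM s v -> in_seqM s (f v).
Proof.
move=> [w ->]; exists (fun i => f (w i)).
by rewrite linear_sum; apply: eq_bigr => i _; rewrite linearZ.
Qed.

Lemma in_seqM_scale (R : comNzRingType) (M : lmodType R) s (a : R^o) (v : M) :
  in_seqM s a -> in_seqM s (a *: v).
Proof.
move=> [w ->]; exists (fun i => w i *: v).
by rewrite scaler_suml; apply: eq_bigr => i _; rewrite -scalerA.
Qed.

(** * Zorn's lemma and prime ideals *)

Section Zorn.
Local Open Scope classical_set_scope.

Lemma zorn_above (T : Type) (P : set T -> Prop) (A : set T) :
  P A ->
  (forall F : set (set T), F !=set0 -> F `<=` P -> total_on F subset ->
     P (\bigcup_(X in F) X)) ->
  exists B, [/\ A `<=` B, P B & forall C, B `<=` C -> P C -> C `<=` B].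
Proof.
move=> PA Pchain.
(* Adding A to every set makes the empty chain harmless and keeps the maximal set above A. *)
have [|B [PB Bmax]] := @Zorn_bigcup T (fun X => P (X `|` A)).
  move=> F FP Ftot; have [->|/set0P [X0 FX0]] := eqVneq F set0.
    by rewrite bigcup_set0 set0U.
  have -> : \bigcup_(X in F) X `|` A = \bigcup_(Y in (setU^~ A) @` F) Y.
    apply/seteqP; split=> [t [[X FX Xt]|At]|t [_ [X FX <-] [Xt|At]]].
    - by exists (X `|` A); [exists X|left].
    - by exists (X0 `|` A); [exists X0|right].
    - by left; exists X.
    - by right.
  apply: Pchain => [||_ _ [X FX <-] [Y FY <-]].
  - by exists (X0 `|` A), X0.
  - by move=> _ [X FX <-]; apply: FP.
  - by case: (Ftot X Y FX FY) => XY; [left|right]; apply: setSU.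
exists (B `|` A); split=> // C BC PC t Ct; apply: contrapT => Bt.
apply: (Bmax C); last first.
  rewrite (_ : C `|` A = C) //; apply/setUidPl => a Aa.
  by apply: BC; right.
split=> [a Ba|CB]; first by apply: BC; left.
by apply: Bt; left; apply: CB.
Qed.

End Zorn.

Section Primes.
Local Open Scope classical_set_scope.
Variable R : comNzRingType.

Definition ideal_set (I : set R) : Prop :=
  I 0 /\ forall a u v, I u -> I v -> I (a * u + v).

Lemma ideal_setM I a u : ideal_set I -> I u -> I (a * u).
Proof. by move=> [I0 IP] Iu; rewrite -[_ * _]addr0; apply: IP. Qed.

Lemma ideal_pack (I : set R) : ideal_set I -> ~ I 1 ->
  exists J : idealr R, forall x, x \in J <-> I x.
Proof.
move=> [I0 IP] I1.
have Icl : idealr_closed (fun x => `[< I x >]).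
  split; [exact/asboolP|exact/asboolP|].
  by move=> a u v /asboolP Iu /asboolP Iv; apply/asboolP/IP.
exists (HB.pack_for (idealr R) (fun x => `[< I x >]) (isIdealr.Build R _ Icl)).
by move=> x; split=> /asboolP.
Qed.

Lemma prime_ideal_pack (I : set R) : ideal_set I -> ~ I 1 ->
  (forall u v, I (u * v) -> I u \/ I v) ->
  exists J : prime_idealr R, forall x, x \in J <-> I x.
Proof.
move=> [I0 IP] I1 Iprime.
have Icl : idealr_closed (fun x => `[< I x >]).
  split; [exact/asboolP|exact/asboolP|].
  by move=> a u v /asboolP Iu /asboolP Iv; apply/asboolP/IP.
have Ipr : prime_idealr_closed (fun x => `[< I x >]).
  by move=> u v /asboolP /Iprime [] Iu; apply/orP; [left|right]; apply/asboolP.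
exists (HB.pack_for (prime_idealr R) (fun x => `[< I x >]) (isIdealr.Build R _ Icl)
  (isPrimeIdealrClosed.Build R _ Ipr)).
by move=> x; split=> /asboolP.
Qed.

Lemma maximal_disjoint (I S : set R) : ideal_set I -> (forall x, I x -> ~ S x) ->
  exists J, [/\ I `<=` J, ideal_set J, forall x, J x -> ~ S x &
    forall K, J `<=` K -> ideal_set K -> (forall x, K x -> ~ S x) -> K `<=` J].
Proof.
move=> idI IS.
have [||J [IJ [idJ JS] Jmax]] := @zorn_above R
  (fun J => ideal_set J /\ forall x, J x -> ~ S x) I.
- by [].
- move=> F [X0 FX0] FP Ftot; split; last first.
    by move=> x [X /FP [_ XS]] /XS.
  split; first by exists X0 => //; have [[]] := FP _ FX0.
  move=> a u v [X FX Xu] [Y FY Yv].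
  have [XY|YX] := Ftot X Y FX FY.
    exists Y => //; have [[_ YP] _] := FP _ FY; apply: YP => //; exact: XY.
  exists X => //; have [[_ XP] _] := FP _ FX; apply: XP => //; exact: YX.
by exists J; split=> // K JK idK KS; apply: Jmax.
Qed.

Lemma ideal_set_add (J : set R) b : ideal_set J ->
  ideal_set [set z | exists r y, J y /\ z = r * b + y].
Proof.
move=> [J0 JP]; split; first by exists 0, 0; rewrite mul0r addr0.
move=> a _ _ [r [y [Jy ->]]] [r' [y' [Jy' ->]]].
exists (a * r + r'), (a * y + y'); split; first exact: JP.
by rewrite mulrDr mulrDl !mulrA addrACA.
Qed.

(** An ideal J maximal among those containing I and missing S is prime: for u and v outside J, some
    r u + y and t v + z lie in S, and their product would lie in J if u v did. *)
Lemma prime_avoiding (I S : set R) : ideal_set I -> S 1 ->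
  (forall u v, S u -> S v -> S (u * v)) -> (forall x, I x -> ~ S x) ->
  exists p : prime_idealr R,
    (forall x, I x -> x \in p) /\ (forall x, S x -> x \notin p).
Proof.
move=> idI S1 SM IS; have [J [IJ idJ JS Jmax]] := maximal_disjoint idI IS.
have Jmeet b : ~ J b -> exists r y, J y /\ S (r * b + y).
  move=> Jb; apply: contrapT => noS; apply: Jb.
  apply: (Jmax _ _ (ideal_set_add b idJ)) => [y Jy|x [r [y [Jy ->]]] Sx|].
  - by exists 0, y; rewrite mul0r add0r.
  - by apply: noS; exists r, y.
  - by exists 1, 0; rewrite mul1r addr0; split=> //; case: idJ.
have [||p pE] := @prime_ideal_pack J idJ.
- by move=> /JS.
- move=> u v Juv; have [Ju|/Jmeet [r [y [Jy Sy]]]] := pselect (J u); first by left.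
  right; apply: contrapT => /Jmeet [t [z [Jz Sz]]].
  apply: (JS _ _ (SM _ _ Sy Sz)).
  have -> : (r * u + y) * (t * v + z) =
      (r * t) * (u * v) + (r * u * z + ((t * v) * y + z * y)).
    by ring.
  apply: (proj2 idJ) => //; apply: (proj2 idJ) => //.
  by apply: (proj2 idJ) => //; apply: ideal_setM.
- exists p; split=> x; first by move=> /IJ /pE.
  by move=> Sx; apply/negP => /pE /JS.
Qed.

Variable m : idealr R.
Hypothesis R_local : local_ring m.

Lemma local_proper (I : set R) : ideal_set I -> ~ I 1 -> forall x, I x -> x \in m.
Proof.
move=> idI I1.
have [|J [IJ idJ J1 Jmax]] := @maximal_disjoint I [set 1] idI.
  by move=> x Ix x1; apply: I1; rewrite -x1.
have [|n nE] := ideal_pack idJ; first by move=> Jone; apply: (J1 1).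
have [_ mE] := R_local.
have nmax : maximal_ideal n.
  move=> K nK x xK; apply/nE.
  apply: (Jmax (fun x => x \in K)) => //.
  - by move=> y /nE yn; apply: nK.
  - split; first exact: rpred0.
    by move=> a u v Ku Kv; apply: rpredD => //; apply: idealMr.
  - by move=> y Ky y1; move: Ky; rewrite y1 idealr1.
by move=> x Ix; rewrite -(mE _ nmax); apply/nE/IJ.
Qed.

Lemma local_unit r : r \notin m -> exists u, u * r = 1.
Proof.
move=> rm; apply: contrapT => nou; move/negP: rm; apply.
apply: (@local_proper [set z | exists u, z = u * r]); last by exists 1; rewrite mul1r.
- split; first by exists 0; rewrite mul0r.
  by move=> a _ _ [u ->] [v ->]; exists (a * u + v); rewrite mulrDl mulrA.
- by move=> [u uE]; apply: nou; exists u.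
Qed.

Lemma local_unit1B r : r \in m -> exists u, u * (1 - r) = 1.
Proof.
move=> rm; apply: local_unit; apply/negP => rm'.
by have := rpredD rm rm'; rewrite addrC subrK idealr1.
Qed.

Lemma in_seqM_ideal (s : seq R) : ideal_set (fun a : R^o => in_seqM s a).
Proof. by split; [exact: in_seqM0|move=> a u v; apply: (@in_seqMP R R^o)]. Qed.

(* Going down from P to a prime over take n s that avoids the nth element: the
   multiplicative set of the s`_n ^+ k * y with y outside P misses (take n s) by
   regularity. *)
Lemma regular_prime_chain (s : seq R) (n : nat) (P : prime_idealr R) :
  regular_seq (R^o : lmodType R) s -> (n <= size s)%N ->
  {subset take n s <= P} ->
  exists p, prime_chain n p /\ p n = P.
Proof.
move=> [reg _]; elim: n P => [|n IHn] P ns sP.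
  by exists (fun=> P); split.
have xP : s`_n \in P.
  by apply: sP; rewrite (take_nth 0 ns) mem_rcons mem_head.
pose S := [set z | exists k y, y \notin P /\ z = s`_n ^+ k * y].
have [||||Q [IQ SQ]] := @prime_avoiding (fun a : R^o => in_seqM (take n s) a) S.
- exact: in_seqM_ideal.
- by exists 0, 1; rewrite idealr1 expr0 mulr1.
- move=> _ _ [k [y [Py ->]]] [l [z [Pz ->]]]; exists (k + l)%N, (y * z).
  by rewrite prime_idealrM negb_or Py Pz exprD mulrACA.
- move=> x Ix [k [y [Py xE]]]; move: Ix; rewrite {}xE {x}.
  elim: k => [|k IHk].
    rewrite expr0 mul1r => -[w yE]; move/negP: Py; apply; rewrite yE.
    apply: rpred_sum => i _; rewrite -[_ *: _]/(_ * _) mulrC; apply: idealMr.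
    apply: sP; rewrite (take_nth 0 ns) mem_rcons inE mem_nth ?orbT ?ltn_ord //.
  by rewrite exprS -mulrA => /(reg _ ns); apply: IHk.
have [|p [pc pn]] := IHn Q (ltnW ns).
  move=> x xs; apply: IQ; rewrite -[x]mulr1; exact: (@in_seqM_mem R R^o).
have xQ : s`_n \notin Q by apply: SQ; exists 1, 1; rewrite idealr1 expr1 mulr1.
exists (fun i => if (i <= n)%N then p i else P); rewrite ltnn; split=> // i ile.
have /predU1P [->|ilt] : (i == n) || (i < n)%N by rewrite -leq_eqVlt.
  rewrite leqnn ltnn pn; split=> [y Qy|PQ]; last first.
    by move/negP: xQ; apply; apply: PQ.
  (* With exponent 0, S contains the complement of P, so Q lies in P. *)
  apply: contraT => Py; have := SQ y; rewrite Qy; apply.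
  by exists 0, y; rewrite expr0 mul1r.
by rewrite (ltnW ilt) ilt; apply: pc.
Qed.

(** Otherwise some prime P contains (s) and misses the powers of a. A chain of length d ends at P,
    and m lies strictly above P, which is one step too many. *)
Lemma regular_primary (s : seq R) (d : nat) :
  krull_dim R d -> regular_seq (R^o : lmodType R) s -> size s = d ->
  forall a, a \in m -> exists n, in_seqM s (a ^+ n : R^o).
Proof.
move=> [_ dmax] reg sd a am; apply: contrapT => npow.
have [||||P [IP SP]] := @prime_avoiding (fun a : R^o => in_seqM s a)
    [set z | exists n, z = a ^+ n].
- exact: in_seqM_ideal.
- by exists 0; rewrite expr0.
- by move=> _ _ [k ->] [l ->]; exists (k + l)%N; rewrite exprD.
- by move=> x Ix [n xE]; apply: npow; exists n; rewrite -xE.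
(* A chain consists of [prime_idealr], so its top is a prime M containing m. *)
have [||||M [mM _]] := @prime_avoiding (fun x => x \in m) [set 1].
- by split=> [|b u v um vm]; [exact: rpred0|apply: rpredD => //; apply: idealMr].
- by [].
- by move=> _ _ -> ->; rewrite mulr1.
- by move=> x xm x1; move: xm; rewrite x1 idealr1.
have [||p [pc pn]] := @regular_prime_chain s d P reg.
- by rewrite sd.
- move=> x; rewrite -sd take_size => xs; apply: IP.
  by rewrite -[x]mulr1; exact: (@in_seqM_mem R R^o).
suff pc' : prime_chain d.+1 (fun i => if (i <= d)%N then p i else M).
  by have := dmax _ _ pc'; rewrite ltnn.
move=> i ile.
have /predU1P [->|ilt] : (i == d) || (i < d)%N by rewrite -leq_eqVlt.
  2: by rewrite (ltnW ilt) ilt; apply: pc.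
rewrite leqnn ltnn pn; split=> [x xP|MP].
  apply: mM; apply: (@local_proper (fun x => x \in P)) => //.
    by split=> [|b u v um vm]; [exact: rpred0|apply: rpredD => //; apply: idealMr].
  by rewrite idealr1.
have /negP : a \notin P by apply: SP; exists 1%N; rewrite expr1.
apply.
by apply: MP; apply: mM.
Qed.

End Primes.

(** * The Koszul complex *)

Section PairMaps.
Variables (R : comNzRingType) (U V W : lmodType R).
Variables (f : {linear U -> V}) (g : {linear U -> W}).

Fact pair_map_linear : linear (fun u => (f u, g u)).
Proof. by move=> a u v; rewrite !linearP. Qed.
Definition pair_map : {linear U -> (V * W)%type} :=
  HB.pack_for {linear U -> (V * W)%type} (fun u => (f u, g u))
    (GRing.isLinear.Build R U (V * W)%type _ _ pair_map_linear).

End PairMaps.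

Lemma ext_vanish_prod (R : comNzRingType) (N U V : lmodType R) i :
  ext_vanish i N U -> ext_vanish i N V -> ext_vanish i N (U * V)%type.
Proof.
case: i => [|i] EU EV phi.
  move=> u; rewrite [LHS]surjective_pairing.
  by congr (_, _); [apply: (EU (fst \o phi))|apply: (EV (snd \o phi))].
have [psi psiE] := EU (fst \o phi); have [psi' psi'E] := EV (snd \o phi).
exists (pair_map psi psi') => u.
by rewrite [RHS]surjective_pairing; congr (_, _); [apply: psiE|apply: psi'E].
Qed.

Lemma ext_vanish_trivial (R : comNzRingType) (N U : lmodType R) i :
  (forall u : U, u = 0) -> ext_vanish i N U.
Proof.
move=> U0; case: i => [|i] phi; first by move=> u; apply: U0.
by exists \0 => u; rewrite (U0 (phi u)).
Qed.

(* The Koszul cochain complex of s on M, with degrees shifted by one: kos M s 0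
   is zero and kos M s n.+1 is M^binom(size s, n). *)
Section Koszul.
Variables (R : comNzRingType).
Implicit Types (M : lmodType R) (s : seq R).

Fixpoint kos M s (n : nat) : lmodType R :=
  match s with
  | [::] => if n is 1 then M else 'rV[R]_0
  | _ :: s' => if n is n'.+1 then (kos M s' n'.+1 * kos M s' n')%type else 'rV[R]_0
  end.

(** The complex of [x :: s] is the shifted cone of multiplication by x on the complex of s. *)
Fixpoint kosd M s n : {linear kos M s n -> kos M s n.+1} :=
  match s return {linear kos M s n -> kos M s n.+1} with
  | [::] => \0
  | x :: s' =>
    match n return {linear kos M (x :: s') n -> kos M (x :: s') n.+1} with
    | 0 => \0
    | n'.+1 => pair_map (kosd M s' n'.+1 \o fst)
                 ((mulm x _ \o fst) \- (kosd M s' n' \o snd))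
    end
  end.

Lemma kos0 M s (z : kos M s 0) : z = 0.
Proof. by case: s z => [|x s] z; apply: thinmx0. Qed.

Lemma kosd_cons M x s n (a : kos M s n.+1) (b : kos M s n) :
  kosd M (x :: s) n.+1 (a, b) = (kosd M s n.+1 a, x *: a - kosd M s n b).
Proof. by []. Qed.

Lemma kosdd M s n z : kosd M s n.+1 (kosd M s n z) = 0.
Proof.
elim: s n z => [//|x s IHs] [|n] z; first by rewrite (kos0 z) !linear0.
case: z => a b; rewrite !kosd_cons IHs; congr (_, _).
by rewrite linearB linearZ IHs subr0 subrr.
Qed.

(** Consequently (s) annihilates the Koszul cohomology. For the head of s the homotopy moves the
    second summand to the first; the later elements inherit theirs, with a sign on the second
    summand. *)
Lemma kos_homotopy M s y : y \in s ->
  exists h : forall n, {linear kos M s n.+1 -> kos M s n},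
    forall n z, kosd M s n (h n z) + h n.+1 (kosd M s n.+1 z) = y *: z.
Proof.
elim: s => // x s IHs; rewrite inE => /orP [/eqP ->|/IHs [h hE]].
  exists (fun n => match n return {linear kos M (x :: s) n.+1 -> kos M (x :: s) n} with
    | 0 => \0
    | n'.+1 => pair_map snd \0
    end) => -[|n] [a b].
    rewrite kosd_cons /= add0r (kos0 b) linear0 subr0.
    by congr (_, _); rewrite ?scaler0 // (kos0 (GRing.zero)).
  rewrite -[LHS]/(kosd M (x :: s) n.+1 (b, 0) + (x *: a - kosd M s n.+1 b, 0)).
  rewrite kosd_cons linear0 subr0 -[LHS]/(_, _).
  by congr (_, _); [rewrite addrC subrK|rewrite addr0].
exists (fun n => match n return {linear kos M (x :: s) n.+1 -> kos M (x :: s) n} with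
  | 0 => \0
  | n'.+1 => pair_map (h n'.+1 \o fst) (\- (h n' \o snd))
  end) => -[|n] [a b].
  rewrite kosd_cons [X in X + _]linear0 add0r.
  rewrite -[LHS]/(h 1%N (kosd M s 1 a), - h 0%N (x *: a - kosd M s 0 b)).
  congr (_, _); last by rewrite [LHS]kos0 (kos0 b) scaler0.
  by have := hE 0%N a; rewrite (kos0 (h 0%N a)) linear0 add0r.
rewrite -[LHS]/(kosd M (x :: s) n.+1 (h n.+1 a, - h n b) +
  (h n.+2 (kosd M s n.+2 a), - h n.+1 (x *: a - kosd M s n.+1 b))).
rewrite kosd_cons -[LHS]/(_, _); congr (_, _); first exact: hE.
rewrite linearN opprK linearB linearZ opprD opprK addrACA subrr add0r.
exact: hE.
Qed.

Definition kos_exact M s n : Prop :=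
  forall z : kos M s n.+1, kosd M s n.+1 z = 0 -> exists y, z = kosd M s n y.

(** The top term is M, sitting in the second summand at each step; the first summand is beyond the
    range of the shorter complex. *)
Fixpoint kos_top M s : {linear M -> kos M s (size s).+1} :=
  match s return {linear M -> kos M s (size s).+1} with
  | [::] => idfun
  | x :: s' => pair_map \0 (kos_top M s')
  end.

Fixpoint kos_proj M s : {linear kos M s (size s).+1 -> M} :=
  match s return {linear kos M s (size s).+1 -> M} with
  | [::] => idfun
  | x :: s' => kos_proj M s' \o snd
  end.

Lemma kos_topK M s v : kos_proj M s (kos_top M s v) = v.
Proof. by elim: s v => //= x s IHs v; rewrite IHs. Qed.

Lemma kos_above M s n (z : kos M s n) : ((size s).+1 < n)%N -> z = 0.
Proof.
elim: s n z => [|x s IHs] [|[|n]] //= z; first by move=> _; apply: thinmx0.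
move=> sn; case: z => a b.
by congr (_, _); apply: IHs => //; apply: ltnW.
Qed.

Lemma kos_proj_d M s z : in_seqM s (kos_proj M s (kosd M s (size s) z)).
Proof.
elim: s z => [|x s IHs] z; first by rewrite (kos0 z) !linear0; apply: in_seqM0.
case: z => a b; rewrite kosd_cons /= linearB linearZ.
apply/in_seqM_cons; exists (kos_proj M s a), (- kos_proj M s (kosd M s (size s) b)).
by split=> //; rewrite -scaleN1r; apply: in_seqMZ.
Qed.

Lemma kos_top_d M s v :
  in_seqM s v <-> exists z, kos_top M s v = kosd M s (size s) z.
Proof.
split=> [|[z zE]]; last by rewrite -[v](kos_topK s) zE; apply: kos_proj_d.
elim: s v => [|x s IHs] v; first by move/in_seqM_nil ->; exists 0; rewrite !linear0.
move=> /in_seqM_cons [w [v' [/IHs [b bE] ->]]].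
exists (kos_top M s w, - b).
rewrite kosd_cons -[LHS]/(0, kos_top M s (x *: w + v')); congr (_, _).
  by symmetry; apply: kos_above.
by rewrite linearN opprK linearD linearZ bE.
Qed.

End Koszul.

Section KoszulFunctor.
Variables (R : comNzRingType).
Implicit Types (M N : lmodType R).

Fixpoint kosf M N (f : {linear M -> N}) s n : {linear kos M s n -> kos N s n} :=
  match s return {linear kos M s n -> kos N s n} with
  | [::] => match n return {linear kos M [::] n -> kos N [::] n} with
    | 1 => f
    | _ => \0
    end
  | x :: s' => match n return {linear kos M (x :: s') n -> kos N (x :: s') n} with
    | 0 => \0
    | n'.+1 => pair_map (kosf f s' n'.+1 \o fst) (kosf f s' n' \o snd)
    end
  end.

Lemma kosf_cons M N (f : {linear M -> N}) x s n
    (a : kos M s n.+1) (b : kos M s n) :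
  kosf f (x :: s) n.+1 (a, b) = (kosf f s n.+1 a, kosf f s n b).
Proof. by []. Qed.

Lemma kosf_d M N (f : {linear M -> N}) s n z :
  kosf f s n.+1 (kosd M s n z) = kosd N s n (kosf f s n z).
Proof.
elim: s n z => [|x s IHs] [|n] z; rewrite ?(kos0 z) ?linear0 //.
case: z => a b; rewrite kosd_cons !kosf_cons kosd_cons !IHs.
by rewrite linearB linearZ IHs.
Qed.

Lemma kosf_top M N (f : {linear M -> N}) s v :
  kosf f s (size s).+1 (kos_top M s v) = kos_top N s (f v).
Proof.
by elim: s => //= x s IHs; rewrite -IHs linear0.
Qed.

Variables (L M N : lmodType R) (f : {linear L -> M}) (g : {linear M -> N}).
Hypothesis fg : short_exact f g.

Lemma kosf_exact s n : short_exact (kosf f s n) (kosf g s n).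
Proof.
case: fg => finj exfg gsurj.
have triv (U V W : lmodType R) (u : {linear U -> V}) (v : {linear V -> W}) :
    (forall z : U, z = 0) -> (forall z : V, z = 0) -> (forall z : W, z = 0) ->
    short_exact u v.
  move=> U0 V0 W0; split=> [y z _|y|z]; first by rewrite (U0 y) (U0 z).
    by split=> // _; exists 0; rewrite (V0 y) linear0.
  by exists 0; rewrite (W0 z) linear0.
elim: s n => [|x s IHs] [|n]; first 1 last.
- by case: n => [|n]; [split|apply: triv => z; apply: thinmx0].
- by apply: triv => z; apply: thinmx0.
- have [fi1 ex1 gs1] := IHs n.+1; have [fi0 ex0 gs0] := IHs n.
  split=> [[a b] [a' b'] [/fi1 -> /fi0 ->] //|[a b]|[a b]].
    split=> [[/ex1 [a' ->] /ex0 [b' ->]]|[[a' b'] [-> ->]]].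
      by exists (a', b').
    congr (_, _); [apply/ex1|apply/ex0]; first by exists a'.
    by exists b'.
  by have [a' ->] := gs1 a; have [b' ->] := gs0 b; exists (a', b').
- by apply: triv => z; apply: thinmx0.
Qed.

(** This is the stretch H^(size s - 1) (N) -> L/sL -> M/sM of the long exact Koszul sequence, the
    top cohomology being computed by [kos_top_d]. For empty s it is the injectivity of f. *)
Lemma koszul_reflects s :
  ((0 < size s)%N -> kos_exact N s (size s).-1) ->
  forall v, in_seqM s (f v) -> in_seqM s v.
Proof.
case: s => [_ v|x s] /=.
  move=> /in_seqM_nil fv; apply/in_seqM_nil.
  by case: fg => finj _ _; apply: finj; rewrite fv linear0.
move=> /(_ isT); set t := x :: s => Nex v /kos_top_d [z zE].
have [finj exfg _] := kosf_exact t (size t).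
have [finj' exfg' _] := kosf_exact t (size t).+1.
have [_ _ gsurj] := kosf_exact t (size s).
have [|y yE] := Nex (kosf g t (size t) z).
  rewrite -kosf_d -zE kosf_top.
  have -> : g (f v) = 0 by case: fg => _ /(_ (f v)) [_ gf] _; apply: gf; exists v.
  by rewrite linear0.
have [y' y'E] := gsurj y.
have /exfg [z' z'E] : kosf g t (size t) (z - kosd M t (size s) y') = 0.
  by rewrite linearB yE y'E -kosf_d subrr.
apply/kos_top_d; exists z'; apply: finj'.
rewrite kosf_top zE kosf_d -z'E linearB.
by rewrite -[X in _ - X]/(kosd M t (size s).+1 _) kosdd subr0.
Qed.

End KoszulFunctor.

(** * Noetherian modules *)

Section Span.
Variables (R : comNzRingType).
Implicit Types U V M : lmodType R.

Fixpoint span V (gs : seq V) (v : V) : Prop :=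
  if gs is g :: gs' then exists a w, span gs' w /\ v = a *: g + w else v = 0.

Lemma spanE V (gs : seq V) v :
  span gs v <-> exists c : nat -> R, v = \sum_(i < size gs) c i *: gs`_i.
Proof.
elim: gs v => [|g gs IHgs] v /=.
  by split=> [->|[c ->]]; [exists (fun=> 0)|]; rewrite big_ord0.
split=> [[a [w [/IHgs [c ->] ->]]]|[c ->]].
  by exists (fun i => if i is j.+1 then c j else a); rewrite big_ord_recl.
exists (c 0%N), (\sum_(i < size gs) c i.+1 *: gs`_i).
by rewrite big_ord_recl; split=> //; apply/IHgs; exists (fun i => c i.+1).
Qed.

Lemma spanP V (gs : seq V) a u v :
  span gs u -> span gs v -> span gs (a *: u + v).
Proof.
elim: gs u v => [|g gs IHgs] u v /=; first by move=> -> ->; rewrite scaler0 addr0.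
move=> [b [w [sw ->]]] [c [z [sz ->]]]; exists (a * b + c), (a *: w + z).
by split; [apply: IHgs|rewrite scalerDr scalerA scalerDl addrACA].
Qed.

Lemma span0 V (gs : seq V) : span gs 0.
Proof.
by elim: gs => //= g gs IHgs; exists 0, 0; rewrite scale0r addr0.
Qed.

Lemma span_cat V (gs hs : seq V) u v :
  span gs u -> span hs v -> span (gs ++ hs) (u + v).
Proof.
elim: gs u => [|g gs IHgs] u /=; first by move=> ->; rewrite add0r.
move=> [a [w [sw ->]]] sv; exists a, (w + v).
by rewrite addrA; split=> //; apply: IHgs.
Qed.

Definition submod_set V (S : V -> Prop) : Prop :=
  S 0 /\ forall a u v, S u -> S v -> S (a *: u + v).

Lemma span_submod V (gs : seq V) (S : V -> Prop) v :
  submod_set S -> (forall g, g \in gs -> S g) -> span gs v -> S v.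
Proof.
move=> [S0 SP]; elim: gs v => [|g gs IHgs] v Sgs /=; first by move=> ->.
move=> [a [w [sw ->]]]; apply: SP; first by apply: Sgs; rewrite mem_head.
by apply: IHgs => // h hgs; apply: Sgs; rewrite inE hgs orbT.
Qed.

Lemma span_map U V (f : {linear U -> V}) gs u :
  span gs u -> span (map f gs) (f u).
Proof.
elim: gs u => [|g gs IHgs] u /=; first by move=> ->; rewrite linear0.
by move=> [a [w [sw ->]]]; exists a, (f w); rewrite linearP; split=> //; apply: IHgs.
Qed.

Lemma fin_genP V : fin_gen V <-> exists gs : seq V, forall v, span gs v.
Proof. by split=> -[gs gsP]; exists gs => v; apply/spanE. Qed.

Lemma fin_gen_surj U V (f : {linear U -> V}) :
  (forall v, exists u, v = f u) -> fin_gen U -> fin_gen V.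
Proof.
move=> fsurj /fin_genP [gs gsP]; apply/fin_genP; exists (map f gs) => v.
by have [u ->] := fsurj v; apply: span_map.
Qed.

Lemma fin_gen_prod U V : fin_gen U -> fin_gen V -> fin_gen (U * V)%type.
Proof.
move=> /fin_genP [gs gsP] /fin_genP [hs hsP]; apply/fin_genP.
exists (map (pair_map idfun \0) gs ++ map (pair_map \0 idfun) hs) => -[u v].
rewrite (_ : (u, v) = pair_map idfun \0 u + pair_map \0 idfun v).
  by apply: span_cat; apply: span_map.
by rewrite -[RHS]/(_, _) /= addr0 add0r.
Qed.

Lemma fin_gen_kos M s n : fin_gen M -> fin_gen (kos M s n).
Proof.
have fg0 : fin_gen ('rV[R]_0).
  by apply/fin_genP; exists [::] => v; apply: thinmx0.
by move=> fgM; elim: s n => [|x s IHs] [|[|n]] //; apply: fin_gen_prod.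
Qed.

Definition noetherian_mod V : Prop :=
  forall S : V -> Prop, submod_set S ->
    exists gs, (forall g, g \in gs -> S g) /\ forall v, S v -> span gs v.

Hypothesis R_noetherian : noetherian R.

Lemma noetherian_ideal : noetherian_mod (R^o : lmodType R).
Proof.
move=> S [S0 SP].
have Scl : submod_closed (fun x : R^o => `[< S x >]).
  split; first exact/asboolP.
  by move=> a u v /asboolP Su /asboolP Sv; apply/asboolP/SP.
pose S' : submodClosed R^o := HB.pack_for (submodClosed R^o)
  (fun x : R^o => `[< S x >]) (GRing.isSubmodClosed.Build R R^o _ Scl).
have [gs gsP] := (fin_genP (submod S')).1 (R_noetherian S').
exists (map val gs); split=> [_ /mapP [g _ ->]|v Sv].
  by have /asboolP := valP g.
have vS' : v \in S' by apply/asboolP.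
exact: (span_map (val : {linear submod S' -> R^o}) (gsP (Submod vS'))).
Qed.

(** Induction on the generators: the coefficients of e in elements of S form an ideal. Elements of S
    realizing generators of this ideal, with generators of the part of S inside [span gs], generate
    S. *)
Lemma fin_gen_noetherian V : fin_gen V -> noetherian_mod V.
Proof.
move=> /fin_genP [gs gsP].
suff H S : submod_set S -> (forall v, S v -> span gs v) ->
    exists hs, (forall h, h \in hs -> S h) /\ forall v, S v -> span hs v.
  by move=> S idS; apply: H.
elim: gs {gsP} S => [|e gs IHgs] S [S0 SP] Sgs; first by exists [::].
pose I (a : R^o) := exists w, span gs w /\ S (a *: e + w).
have idI : submod_set I.
  split; first by exists 0; rewrite scale0r addr0; split=> //; apply: span0.
  move=> a b c [w [sw Sw]] [z [sz Sz]]; exists (a *: w + z); split.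
    exact: spanP.
  rewrite (_ : _ + _ = a *: (b *: e + w) + (c *: e + z)); first exact: SP.
  by rewrite scalerDr scalerA scalerDl addrACA.
have [as_ [asI asP]] := noetherian_ideal idI.
have [|hs [hsS hsP]] := IHgs (fun v => S v /\ span gs v) _ (fun v => @proj2 _ _).
  split=> [|a u v [Su su] [Sv sv]]; first by split=> //; apply: span0.
  by split; [apply: SP|apply: spanP].
have [vs [vsS vsP]] : exists vs, (forall v, v \in vs -> S v) /\
    forall a, span as_ a -> exists w, span gs w /\ span vs (a *: e + w).
  elim: as_ asI {asP} => [|b bs IHbs] bsI.
    exists [::]; split=> // a /= ->; exists 0.
    by rewrite scale0r addr0; split=> //; apply: span0.
  have [|vs [vsS vsP]] := IHbs.
    by move=> c cbs; apply: bsI; rewrite inE cbs orbT.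
  have [|z [sz Sz]] := bsI b; first exact: mem_head.
  exists (b *: e + z :: vs); split=> [v|_ [r [c [/vsP [w [sw sw']] ->]]]].
    by rewrite inE => /predU1P [->|/vsS].
  exists (r *: z + w); split; first exact: spanP.
  exists r, (c *: e + w); split=> //.
  by rewrite scalerDr scalerA scalerDl addrACA.
exists (vs ++ hs); split=> [v|v Sv].
  by rewrite mem_cat => /orP [/vsS|/hsS []].
have [a [w [sw vE]]] := Sgs _ Sv.
have [|z [sz sz']] := vsP a; first by apply: asP; exists w; rewrite -vE.
have Sz : S (a *: e + z) by apply: span_submod sz'.
rewrite (_ : v = (a *: e + z) + (w - z)); last by rewrite vE -addrA (addrC z) subrK.
apply: span_cat => //; apply: hsP; split.
  rewrite (_ : w - z = -1 *: (a *: e + z) + v); first exact: SP.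
  by rewrite scaleN1r vE opprD addrACA addNr add0r addrC.
by rewrite addrC -scaleN1r; apply: spanP.
Qed.

End Span.

Section Nakayama.
Variables (R : comNzRingType) (m : idealr R).
Hypothesis R_local : local_ring m.

(** If g = x w' and w' = b g + y, then (1 - b x) g = x y with 1 - b x a unit, so g is a redundant
    generator of W. Discarding generators one at a time leaves none. *)
Lemma nakayama (V : lmodType R) (x : R) (W : V -> Prop) :
  noetherian_mod V -> x \in m -> submod_set W ->
  (forall w, W w -> exists w', W w' /\ w = x *: w') ->
  forall w, W w -> w = 0.
Proof.
move=> Vnoeth xm Wsub Wx.
have [gs [Wgs gsP]] := Vnoeth W Wsub.
elim: gs Wgs gsP => [//|g gs IHgs] Wgs gsP; apply: IHgs => [h hgs|w Ww].
  by apply: Wgs; rewrite inE hgs orbT.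
have [a [z [sz ->]]] := gsP w Ww.
suff sg : span gs g by apply: spanP.
have [w' [Ww' gE]] := Wx g (Wgs g (mem_head _ _)).
have [b [y [sy w'E]]] := gsP w' Ww'.
have [u uE] := local_unit1B R_local (idealMr b xm).
have -> : g = (u * x) *: y + 0.
  rewrite addr0 -[LHS]scale1r -uE -!scalerA; congr (_ *: _).
  rewrite scalerBl scale1r {1}gE w'E scalerDr !scalerA (mulrC b).
  by rewrite addrAC subrr add0r.
by apply: spanP => //; apply: span0.
Qed.

End Nakayama.

(** * Depth *)

Section Socle.
Variables (R : comNzRingType) (m : idealr R).
Hypothesis R_noetherian : noetherian R.
Implicit Types V : lmodType R.

Lemma max_ideal_gens :
  exists gs : seq R, {subset gs <= m} /\ forall a, a \in m -> span (gs : seq R^o) a.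
Proof.
have [|gs [gsm gsP]] := @noetherian_ideal R R_noetherian (fun a => a \in m).
  by split=> [|a u v um vm]; [apply: rpred0|apply: rpredD => //; apply: idealMr].
by exists gs.
Qed.

(** For each generator g of m in turn, multiply by the last power of g that stays outside P. The
    outcome is a nonzero socle element of V/P. *)
Lemma socle_mod V (P : V -> Prop) v :
  submod_set P -> ~ P v -> (forall a, a \in m -> exists n, P (a ^+ n *: v)) ->
  exists r, ~ P (r *: v) /\ forall a, a \in m -> P (a *: (r *: v)).
Proof.
move=> Psub Pv vnil; have [gs [gsm gsP]] := max_ideal_gens.
have PZ a u : P u -> P (a *: u).
  by case: Psub => P0 PP Pu; rewrite -[_ *: _]addr0; apply: PP.
suff [r [Pr rP]] : exists r, ~ P (r *: v) /\ forall a, a \in gs -> P (a *: (r *: v)).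
  exists r; split=> // a /gsP.
  apply: (@span_submod _ R^o gs (fun a => P (a *: (r *: v)))) => //.
  case: Psub => P0 PP; split; first by rewrite scale0r.
  by move=> b x y Px Py; rewrite scalerDl -[b *: x]/(b * x) -scalerA; apply: PP.
elim: gs gsm {gsP} => [|g gs IHgs] gsm; first by exists 1; rewrite scale1r.
have [|r [Pr rP]] := IHgs; first by move=> a ags; apply: gsm; rewrite inE ags orbT.
have gnil : exists n, `[< P (g ^+ n *: (r *: v)) >].
  have [|n Pn] := vnil g; first by apply: gsm; rewrite mem_head.
  by exists n; apply/asboolP; rewrite scalerA mulrC -scalerA; apply: PZ.
case: (ex_minnP gnil) => -[|n]; first by move=> /asboolP; rewrite scale1r.
move=> /asboolP Pn nmin; exists (g ^+ n * r); split.
  move=> Pn'; have := nmin n; rewrite ltnn => H.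
  by suff: false by []; apply: H; apply/asboolP; rewrite scalerA.
move=> a; rewrite inE => /predU1P [->|/rP Pa].
  by move: Pn; rewrite !scalerA exprS mulrA.
by rewrite scalerA mulrC -mulrA -scalerA (mulrC r) -scalerA; apply: PZ.
Qed.

Lemma residue_proj : exists p : {linear R^o -> residue m},
  (forall z, exists r, z = p r) /\ forall r, p r = 0 <-> r \in m.
Proof.
have plin : linear (fun a : R^o => (\pi_({ideal_quot m}) a)%qT : residue m).
  move=> a u v; rewrite -[a *: u]/(a * u).
  by rewrite [LHS]pi_addr [X in X + _]pi_mulr.
have [p pE] := linear_of_fun plin; exists p; split=> [z|r].
  by exists (repr z); rewrite pE reprK.
have -> : (r \in m) = (p r == p 0).
  by rewrite -[r in LHS]subr0 Quotient.idealrBE !pE.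
by rewrite linear0; split=> /eqP.
Qed.

Lemma residue_hom V (w : V) : (forall a, a \in m -> a *: w = 0) ->
  exists phi : {linear residue m -> V}, exists u, phi u = w.
Proof.
move=> mw.
have [p [psurj pker]] := residue_proj.
have flin : linear (fun a : R^o => a *: w).
  by move=> a u v; rewrite scalerDl -scalerA.
have [f fE] := linear_of_fun flin.
have [|phi phiE] := factor_surj (f := f) psurj.
  by move=> u /pker um; rewrite fE mw.
by exists phi, (p 1); rewrite phiE fE scale1r.
Qed.

Lemma socle_zero V (v : V) : ext_vanish 0 (residue m) V ->
  (forall a, a \in m -> exists n, a ^+ n *: v = 0) -> v = 0.
Proof.
move=> EV vnil; apply: contrapT => v0.
have [|r [rv0 mrv]] := @socle_mod V (fun v : V => v = 0) v _ v0 vnil.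
  by split=> // a _ _ -> ->; rewrite scaler0 addr0.
by have [phi [u phiu]] := residue_hom mrv; apply: rv0; rewrite -phiu.
Qed.

End Socle.

Lemma in_seqM_kill (R : comNzRingType) (V : lmodType R) (s : seq R) (b : R) (v : V) :
  in_seqM s (b : R^o) -> (forall y, y \in s -> y *: v = 0) -> b *: v = 0.
Proof.
move=> [w ->] sv; rewrite scaler_suml big1 // => i _.
by rewrite -[_ *: w i]/(_ * w i) mulrC -scalerA sv ?scaler0 ?mem_nth.
Qed.

Section KoszulDepth.
Variables (R : comNzRingType) (m : idealr R).
Hypothesis R_noetherian : noetherian R.
Variable s : seq R.
Hypothesis s_primary : forall a, a \in m -> exists n, in_seqM s (a ^+ n : R^o).

Variables (M : lmodType R) (d : nat).
Hypothesis M_depth : forall i, (i < d)%N -> ext_vanish i (residue m) M.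

Lemma ext_vanish_kos i t n : (i < d)%N -> ext_vanish i (residue m) (kos M t n).
Proof.
move=> /M_depth Ei; elim: t n => [|x t IHt] [|n] /=.
- by apply: ext_vanish_trivial => u; apply: thinmx0.
- by case: n => [//|n]; apply: ext_vanish_trivial => u; apply: thinmx0.
- by apply: ext_vanish_trivial => u; apply: thinmx0.
- exact: ext_vanish_prod.
Qed.

(* By induction on n, the complex is exact up to degree n and its nth cokernel
   has depth at least d - n. *)
Let coker n : lmodType R := quotmod (im (kosd M s n)).

(** The class of a cocycle in the cokernel is killed by s through the homotopy, hence by a power of
    each element of m; as Hom (k, coker) = 0, it is zero. *)
Let exact_of_coker n : ext_vanish 0 (residue m) (coker n) -> kos_exact M s n.
Proof.
move=> EC z dz; apply/imP/quo_eq0; apply: (socle_zero R_noetherian EC) => a am.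
have [N aN] := s_primary am; exists N; apply: in_seqM_kill aN _ => y ys.
have [h hE] := kos_homotopy M ys; rewrite -linearZ; apply/quo_eq0/imP.
by exists (h n z); rewrite -hE dz linear0 addr0.
Qed.

(** Exactness in degree n embeds the nth cokernel in the next term, with the following cokernel as
    quotient; this costs one degree of Ext. *)
Let coker_depth n i : (i + n < d)%N -> ext_vanish i (residue m) (coker n).
Proof.
elim: n i => [|n IHn] i id.
  have ses : short_exact (kosd M s 0) (quo (im (kosd M s 0))).
    split=> [u v _|y|z]; first by rewrite (kos0 u) (kos0 v).
      by rewrite quo_eq0 imP.
    exact: quo_surj.
  apply: (ext_vanish_coker ses); first by apply: ext_vanish_kos; rewrite addn0 in id.
  by apply: ext_vanish_trivial; apply: kos0.
have ex : kos_exact M s n.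
  by apply/exact_of_coker/IHn; apply: leq_ltn_trans id; rewrite leq_add // leqW.
have [||del delE] := @factor_surj _ _ _ _ (quo (im (kosd M s n))) (kosd M s n.+1).
- exact: quo_surj.
- by move=> u /quo_eq0/imP [y ->]; rewrite kosdd.
have ses : short_exact del (quo (im (kosd M s n.+1))).
  split=> [|y|z]; last exact: quo_surj.
    apply: inj_ker0 => x; have [u ->] := quo_surj x.
    by rewrite delE => /ex [y ->]; apply/quo_eq0/imP; exists y.
  rewrite quo_eq0 imP; split=> -[x ->].
    by exists (quo (im (kosd M s n)) x); rewrite delE.
  by have [u ->] := quo_surj x; exists u; rewrite delE.
apply: (ext_vanish_coker ses); last by apply: IHn; rewrite addSnnS.
by apply: ext_vanish_kos; apply: leq_ltn_trans id; rewrite leq_addr.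
Qed.

Lemma koszul_exact n : (n < d)%N -> kos_exact M s n.
Proof. by move=> nd; apply/exact_of_coker/coker_depth. Qed.

End KoszulDepth.

Section Regular.
Variables (R : comNzRingType).

(** Stated on successive quotients, so that an induction on s can change the module; Q = sQ is
    allowed. *)
Fixpoint weakly_regular (Q : lmodType R) (s : seq R) : Prop :=
  if s is x :: s' then injective (mulm x Q) /\ weakly_regular (modm x Q) s' else True.

Fixpoint quot_seq (Q : lmodType R) (s : seq R) : lmodType R :=
  if s is x :: s' then quot_seq (modm x Q) s' else Q.

Lemma in_seqM_quom x (Q : lmodType R) s v :
  in_seqM s (quom x Q v) <-> in_seqM (x :: s) v.
Proof.
split=> [[w vE]|/in_seqM_cons [w [v' [sv' ->]]]]; last first.
  rewrite linearD; apply: in_seqMD; last exact: in_seqM_map.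
  by rewrite (_ : quom x Q (x *: w) = 0) ?quom_eq0; [apply: in_seqM0|exists w].
have [u uE] := choice (fun i => @quom_surj R x Q (w i)).
have /quom_eq0 [z zE] : quom x Q (v - \sum_(i < size s) s`_i *: u i) = 0.
  rewrite linearB linear_sum vE; apply/eqP; rewrite subr_eq0; apply/eqP.
  by apply: eq_bigr => i _; rewrite uE linearZ.
apply/in_seqM_cons; exists z, (\sum_(i < size s) s`_i *: u i).
by split; [exists u|rewrite -zE subrK].
Qed.

Lemma weakly_regular_of_cancel (Q : lmodType R) s :
  (forall s1 x s2, s = s1 ++ x :: s2 ->
     forall v : Q, in_seqM s1 (x *: v) -> in_seqM s1 v) -> weakly_regular Q s.
Proof.
elim: s Q => //= x s IHs Q reg; split.
  apply: inj_ker0 => v xv; apply/in_seqM_nil; apply: (reg [::] x s) => //.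
  by apply/in_seqM_nil.
apply: IHs => s1 y s2 sE z; have [v ->] := quom_surj z.
rewrite -linearZ => /in_seqM_quom yv; apply/in_seqM_quom.
by apply: (reg (x :: s1) y s2); rewrite ?sE.
Qed.

Variable m : idealr R.
Hypothesis R_local : local_ring m.
Hypothesis R_noetherian : noetherian R.

(* Rigidity of the Koszul complex: exactness passes to the tail of s by
   Nakayama. *)
Lemma koszul_tail (Q : lmodType R) x s : fin_gen Q -> x \in m ->
  (forall n, (n < (size s).+1)%N -> kos_exact Q (x :: s) n) ->
  forall n, (n < size s)%N -> kos_exact Q s n.
Proof.
move=> fgQ xm ex n ns z dz; pose pi := quo (im (kosd Q s n)).
pose W v := exists2 z, kosd Q s n.+1 z = 0 & v = pi z.
apply/imP/quo_eq0; apply: (nakayama R_local _ xm (W := W)); last by exists z.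
- apply: fin_gen_noetherian => //.
  by apply: (fin_gen_surj (f := pi)); [apply: quo_surj|apply: fin_gen_kos].
- split; first by exists 0; rewrite linear0.
  move=> a _ _ [u du ->] [v dv ->]; exists (a *: u + v); last by rewrite linearP.
  by rewrite linearP du dv scaler0 addr0.
move=> _ [u du ->].
(* (0, u) is a cocycle for [x :: s]. Writing it as the coboundary of (a, b) gives d a = 0 and u = x
   a - d b, so the class of u is x times that of a. *)
have [||[a b]] := ex n.+1 _ (0, u); first by [].
  by rewrite kosd_cons linear0 scaler0 sub0r du oppr0.
rewrite kosd_cons => -[da uE]; exists (pi a); split; first by exists a.
rewrite -linearZ; apply/eqP; rewrite -subr_eq0 -linearB; apply/eqP/quo_eq0/imP.
by exists (- b); rewrite uE linearN addrAC subrr add0r.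
Qed.

Lemma kosd_fst (Q : lmodType R) x s n (a : kos Q s n.+1) (b : kos Q s n) y :
  (a, b) = kosd Q (x :: s) n y -> exists z, a = kosd Q s n z.
Proof.
case: n a b y => [|n] a b y.
  by rewrite (kos0 y) linear0 => -[-> _]; exists 0; rewrite linear0.
by case: y => a' b'; rewrite kosd_cons => -[-> _]; exists a'.
Qed.

(** If x v is the coboundary of b, then (v, b) is a cocycle just below the top degree; being a
    coboundary, it shows in its first component that v lies in sQ. *)
Lemma koszul_cancel (Q : lmodType R) x s :
  kos_exact Q (x :: s) (size s) ->
  forall v : Q, in_seqM s (x *: v) -> in_seqM s v.
Proof.
move=> ex v /kos_top_d [b bE]; apply/kos_top_d.
have [|y yE] := ex (kos_top Q s v, b); last exact: kosd_fst yE.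
by rewrite kosd_cons -linearZ bE subrr; congr (_, _); apply: kos_above.
Qed.

(** [koszul_tail] removes elements from the front, so each element is cancelled modulo those that
    follow it; hence the reversal. *)
Lemma koszul_weakly_regular (Q : lmodType R) s : fin_gen Q -> {subset s <= m} ->
  (forall n, (n < size s)%N -> kos_exact Q s n) -> weakly_regular Q (rev s).
Proof.
move=> fgQ sm ex; apply: weakly_regular_of_cancel => s1 x s2.
move=> /(congr1 rev); rewrite revK rev_cat rev_cons cat_rcons => sE v.
have tail t1 t2 : {subset t1 ++ t2 <= m} ->
    (forall n, (n < size (t1 ++ t2))%N -> kos_exact Q (t1 ++ t2) n) ->
    forall n, (n < size t2)%N -> kos_exact Q t2 n.
  elim: t1 => //= y t1 IHt yt ext; apply: IHt.
    by move=> z zt; apply: yt; rewrite inE zt orbT.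
  by apply: koszul_tail ext => //; apply: yt; rewrite mem_head.
have rs (t : seq R) : {subset t <= rev t} /\ {subset rev t <= t}.
  by split=> z; rewrite mem_rev.
move=> /(in_seqM_sub (proj1 (rs s1))) xv.
apply: (in_seqM_sub (proj2 (rs s1))); apply: koszul_cancel xv.
by apply: (tail (rev s2)); rewrite -?sE.
Qed.

End Regular.

(** * Local cohomology and injectivity modulo a regular sequence *)

Lemma submod_pack (R : comNzRingType) (V : lmodType R) (S : V -> Prop) :
  submod_set S -> exists T : submodClosed V, forall v, v \in T <-> S v.
Proof.
move=> [S0 SP].
have Scl : submod_closed (fun v => `[< S v >]).
  split; first exact/asboolP.
  by move=> a u v /asboolP Su /asboolP Sv; apply/asboolP/SP.
exists (HB.pack_for (submodClosed V) (fun v => `[< S v >])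
  (GRing.isSubmodClosed.Build R V _ Scl)).
by move=> v; split=> /asboolP.
Qed.

Section Localization.
Variables (R : comNzRingType) (Q : lmodType R) (x : R).

(* Q_x is realized as the sequences with q n.+1 = x q n for n large, modulo the
   sequences that vanish for n large; q stands for the common value of
   q n / x^n. *)
Lemma localization_exists : injective (mulm x Q) ->
  exists (L : lmodType R) (iota : {linear Q -> L}),
    [/\ injective iota, injective (mulm x L), forall z : L, exists w, z = x *: w
      & forall z : L, exists n q, x ^+ n *: z = iota q].
Proof.
move=> xinj.
have [|C CE] := @submod_pack R (nat -> Q)
    (fun q => exists N, forall n, (N <= n)%N -> q n.+1 = x *: q n).
  split=> [|a u v [N uN] [N' vN]]; first by exists 0%N => n _; rewrite scaler0.
  exists (maxn N N') => n; rewrite geq_max => /andP [/uN un /vN vn].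
  rewrite -[LHS]/(a *: u n.+1 + v n.+1) -[X in _ = _ *: X]/(a *: u n + v n).
  by rewrite un vn scalerDr !scalerA mulrC.
have [|Z ZE] := @submod_pack R (submod C)
    (fun z => exists N, forall n, (N <= n)%N -> val z n = 0).
  split=> [|a u v [N uN] [N' vN]]; first by exists 0%N.
  exists (maxn N N') => n; rewrite geq_max => /andP [/uN un /vN vn].
  by rewrite -[LHS]/(a *: val u n + val v n) un vn scaler0 addr0.
have cohP (q : nat -> Q) N : (forall n, (N <= n)%N -> q n.+1 = x *: q n) ->
    exists z : submod C, val z = q.
  move=> qN; have qC : q \in C by apply/CE; exists N.
  by exists (Submod qC).
have [j jE] : exists j : {linear Q -> submod C},
    forall q, val (j q) = fun n => x ^+ n *: q.
  have [|||j jE] := @linear_of_rel R Q (submod C)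
    (fun q z => val z = fun n => x ^+ n *: q).
  - by move=> q; apply: (cohP _ 0%N) => n _; rewrite scalerA exprS.
  - by move=> q z w zq wq; apply: val_inj; rewrite zq.
  - move=> a q z q' z' zq zq'; apply/funext => n.
    rewrite -[LHS]/(a *: val z n + val z' n) zq zq'.
    by rewrite scalerDr !scalerA mulrC.
  - by exists j.
have xpow n (q : Q) : x ^+ n *: q = 0 -> q = 0.
  elim: n => [|n IHn]; first by rewrite scale1r.
  rewrite exprS -scalerA => xq; apply: IHn; apply: xinj.
  by rewrite !mulmE xq scaler0.
exists (quotmod Z), (quo Z \o j); split.
- apply: inj_ker0 => q /quo_eq0/ZE [N /(_ N (leqnn N))].
  by rewrite jE => /xpow.
- apply: inj_ker0 => w; have [z ->] := quo_surj w.
  rewrite mulmE -linearZ => /quo_eq0/ZE [N zN]; apply/quo_eq0/ZE.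
  by exists N => n Nn; apply: xinj; rewrite !mulmE scaler0 -(zN n Nn).
- move=> w; have [z ->] := quo_surj w; have /CE [N zN] := valP z.
  (* Delaying the sequence by one divides by x; its value at 0 is a filler. *)
  have [|z' z'E] := cohP (fun n => val z n.-1) N.+1.
    by case=> // n Nn; rewrite zN.
  exists (quo Z z'); apply/eqP; rewrite -linearZ -subr_eq0 -linearB.
  apply/eqP/quo_eq0/ZE; exists N.+1 => -[//|n] Nn.
  rewrite -[LHS]/(val z n.+1 - x *: val z' n.+1) z'E zN //.
  by rewrite subrr.
- move=> w; have [z ->] := quo_surj w; have /CE [N zN] := valP z.
  exists N, (val z N); apply/eqP; rewrite -subr_eq0 -linearZ -linearB.
  apply/eqP/quo_eq0/ZE; exists N => n Nn.
  rewrite -[LHS]/(x ^+ N *: val z n - val (j (val z N)) n) jE.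
  rewrite (_ : val z n = x ^+ (n - N) *: val z N).
    by rewrite scalerA -exprD subnKC // subrr.
  rewrite -{1}(subnK Nn); elim: (n - N)%N => [|k IHk]; first by rewrite scale1r.
  by rewrite addSn zN ?leq_addl // IHk scalerA exprS.
Qed.

(* u identifies U with the kernel of x on the x-divisible, x-power torsion
   module E. *)
Definition x_torsion_ext (U E : lmodType R) (u : {linear U -> E}) : Prop :=
  [/\ injective u, forall e, x *: e = 0 <-> exists v, e = u v,
    forall e : E, exists e', e = x *: e'
    & forall e : E, exists n, x ^+ n *: e = 0].

(** E is Q_x / Q and u is q |-> q / x. Since x kills N and is bijective on Q_x, Ext^i (N, Q_x) = 0,
    so Ext^i (N, E) embeds in Ext^(i+1) (N, Q). *)
Lemma local_cohomology_exists : injective (mulm x Q) ->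
  exists (E : lmodType R) (u : {linear modm x Q -> E}), x_torsion_ext u /\
    forall (N : lmodType R) i, (forall v : N, x *: v = 0) ->
      ext_vanish i.+1 N Q -> ext_vanish i N E.
Proof.
move=> xinj; have [L [iota [iinj Linj Ldiv Ltors]]] := localization_exists xinj.
pose p := quo (im iota).
have ses : short_exact iota p.
  by split=> // [y|]; [rewrite quo_eq0 imP|apply: quo_surj].
have [|theta thetaE] := @factor_inj R Q L L (mulm x L) iota Linj.
  by move=> q; apply: Ldiv.
have [||u uE] := @factor_surj _ _ _ _ (quom x Q) (p \o theta).
- exact: quom_surj.
- move=> q /quom_eq0 [w ->]; apply/quo_eq0/imP; exists w; apply: Linj.
  by rewrite thetaE linearZ.
exists (quotmod (im iota)), u; split; last first.
  move=> N i xN EQ; apply: (ext_vanish_coker ses _ EQ).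
  exact: ext_vanish_bij.
split.
- apply: inj_ker0 => z; have [q ->] := quom_surj z.
  rewrite uE => /quo_eq0/imP [w wE]; apply/quom_eq0; exists w; apply: iinj.
  by rewrite linearZ -wE -thetaE.
- move=> e; split=> [|[v ->]]; last by rewrite -linearZ modm_killed linear0.
  have [l ->] := quo_surj e; rewrite -linearZ => /quo_eq0/imP [q qE].
  exists (quom x Q q); rewrite uE /=; congr (p _); apply: Linj.
  by rewrite thetaE -qE.
- move=> e; have [l ->] := quo_surj e; have [l' ->] := Ldiv l.
  by exists (p l'); rewrite -linearZ.
- move=> e; have [l ->] := quo_surj e; have [n [q lE]] := Ltors l.
  by exists n; rewrite -linearZ; apply/quo_eq0/imP; exists q.
Qed.

(** If y e = 0 with e nonzero, the last nonzero x^n e lies in ker x = U, where y is injective. If x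
    e = y e1, divisibility gives e1 = x e2, and e - y e2 is in U: so ker x on E/yE comes from
    U/yU. *)
Lemma torsion_ext_quot_seq (s : seq R) (U E : lmodType R) (u : {linear U -> E}) :
  x_torsion_ext u -> weakly_regular U s ->
  weakly_regular E s /\
  exists u' : {linear quot_seq U s -> quot_seq E s}, x_torsion_ext u'.
Proof.
elim: s U E u => [|y s IHs] U E u ext /=; first by split=> //; exists u.
move=> [yinj reg]; have [uinj uker udiv utors] := ext.
have yE : injective (mulm y E).
  apply: inj_ker0 => e ye; have [n] := utors e; elim: n => [|n IHn].
    by rewrite scale1r.
  rewrite exprS -scalerA => /uker [v vE]; apply: IHn; rewrite vE.
  suff -> : v = 0 by rewrite linear0.
  apply: yinj; apply: uinj; rewrite !mulmE scaler0 linear0 linearZ /= -vE.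
  by rewrite scalerA mulrC -scalerA -[y *: e]/(mulm y E e) ye scaler0.
have [||u' u'E] := @factor_surj _ _ _ _ (quom y U) (quom y E \o u).
- exact: quom_surj.
- by move=> v /quom_eq0 [w ->]; apply/quom_eq0; exists (u w); rewrite linearZ.
have ext' : x_torsion_ext u'.
  split.
  - apply: inj_ker0 => z; have [v ->] := quom_surj z.
    rewrite u'E => /quom_eq0 [e vE].
    have [w eE] : exists w, e = u w.
      apply/uker; apply: yE; rewrite !mulmE scalerA mulrC -scalerA -vE scaler0.
      by apply/uker; exists v.
    by apply/quom_eq0; exists w; apply: uinj; rewrite linearZ -eE.
  - move=> z; split=> [|[v ->]].
      have [e ->] := quom_surj z; rewrite -linearZ => /quom_eq0 [e1 xe].
      have [e2 e1E] := udiv e1.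
      have [|v vE] := (uker (e - y *: e2)).1.
        by rewrite scalerBr xe e1E !scalerA mulrC subrr.
      exists (quom y U v); rewrite u'E /= -vE linearB.
      by rewrite (_ : quom y E (y *: e2) = 0) ?subr0 // quom_eq0; exists e2.
    have [w ->] := quom_surj v; rewrite u'E /= -linearZ.
    by rewrite (_ : x *: u w = 0) ?linear0 //; apply/uker; exists w.
  - move=> z; have [e ->] := quom_surj z; have [e' ->] := udiv e.
    by exists (quom y E e'); rewrite linearZ.
  - move=> z; have [e ->] := quom_surj z; have [n en] := utors e.
    by exists n; rewrite -linearZ en linear0.
by have [regE [w wext]] := IHs _ _ u' ext' reg; split=> //; exists w.
Qed.

End Localization.

Section Injectivity.
Variables (R : comNzRingType) (m : idealr R).

Lemma ext1_residue (Q : lmodType R) (g : R -> Q) : ext_vanish 1 (residue m) Q ->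
  (forall a r r', r \in m -> r' \in m -> g (a * r + r') = a *: g r + g r') ->
  exists j, forall r, r \in m -> g r = r *: j.
Proof.
move=> EQ glin.
have [p [psurj pker]] := residue_proj m.
(* The resolution starts with the free module on the set k, not with R; h compares the two and sends
   syzygies into m. *)
have [h hE] := res_lift (fun w => psurj (aug (residue m) w)).
have hm u : h (incl _ u) \in m by apply/pker; rewrite hE aug_incl.
have g0 : g 0 = 0.
  have := glin (-1) 0 0 (rpred0 m) (rpred0 m).
  by rewrite mulr0 addr0 scaleN1r addNr.
have philin : linear (fun u => g (h (incl (residue m) u))).
  by move=> a u v; rewrite !linearP glin.
have [phi phiE] := linear_of_fun philin.
have [psi psiE] := EQ phi.
have [e eE] := aug_onto (p 1).
have tm : h e - 1 \in m by apply/pker; rewrite linearB hE -eE subrr.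
(* h e is 1 only modulo m; the second term corrects for the difference. *)
exists (psi e - g (h e - 1)) => r rm.
have [u uE] : exists u, r *: e = incl (residue m) u.
  apply: aug_ker; rewrite linearZ -eE -linearZ; apply/pker.
  by rewrite -[_ *: _]/(r * 1) mulr1.
have hr : h (r *: e) = r * h e by rewrite linearZ.
rewrite scalerBr -linearZ uE psiE phiE -uE hr.
have -> : r * h e = r * (h e - 1) + r by rewrite mulrBr mulr1 subrK.
by rewrite glin // addrAC subrr add0r.
Qed.

(* The Ext^1 of k over R/(s) vanishes: embed Q/sQ in the iterated local
   cohomology module, where g becomes r |-> r e because Ext^1 vanishes there;
   then s e = g(s) = 0 puts e in Q/sQ. *)
Lemma residue_inj (s : seq R) (Q : lmodType R) (g : R -> quot_seq Q s) :
  {subset s <= m} -> weakly_regular Q s -> ext_vanish (size s).+1 (residue m) Q ->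
  (forall a r r', r \in m -> r' \in m -> g (a * r + r') = a *: g r + g r') ->
  (forall r, r \in s -> g r = 0) ->
  exists j, forall r, r \in m -> g r = r *: j.
Proof.
elim: s Q g => [|x s IHs] Q g sm; first by move=> _ EQ glin _; apply: ext1_residue.
move=> [xinj reg] EQ glin gs.
have xm : x \in m by apply: sm; rewrite mem_head.
have [E [u [ext Eext]]] := local_cohomology_exists xinj.
have [regE [u' [uinj uker _ _]]] := torsion_ext_quot_seq ext reg.
have [|||||e eE] := IHs E (u' \o g : R -> quot_seq E s).
- by move=> r rs; apply: sm; rewrite inE rs orbT.
- exact: regE.
- by apply: Eext EQ; apply: residue_killed.
- by move=> a r r' rm rm' /=; rewrite glin // linearP.
- by move=> r rs /=; rewrite gs ?linear0 // inE rs orbT.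
have /uker [j jE] : x *: e = 0.
  by rewrite -eE // /= gs ?linear0 // mem_head.
by exists j => r rm; apply: uinj; rewrite linearZ /= -jE -eE.
Qed.

End Injectivity.

(** * Vanishing of Ext^1 (-, Omega) *)

Lemma quot_seq_killed (R : comNzRingType) (Q : lmodType R) (s : seq R) y :
  y \in s -> forall v : quot_seq Q s, y *: v = 0.
Proof.
have kill t (V : lmodType R) : (forall v : V, y *: v = 0) ->
    forall v : quot_seq V t, y *: v = 0.
  elim: t V => //= x t IHt V yV; apply: IHt => z.
  by have [v ->] := quom_surj z; rewrite -linearZ yV linear0.
elim: s Q => //= x s IHs Q; rewrite inE => /predU1P [yx|ys]; last exact: IHs.
by apply: kill => v; rewrite yx; apply: modm_killed.
Qed.

Section Extension.
Local Open Scope classical_set_scope.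
Variables (R : comNzRingType) (m : idealr R) (s : seq R).
Hypothesis R_local : local_ring m.
Hypothesis R_noetherian : noetherian R.
Hypothesis s_primary : forall a, a \in m -> exists n, in_seqM s (a ^+ n : R^o).
Variable J : lmodType R.
Hypothesis sJ : forall y, y \in s -> forall v : J, y *: v = 0.
Hypothesis J_inj : forall g : R -> J,
  (forall a r r', r \in m -> r' \in m -> g (a * r + r') = a *: g r + g r') ->
  (forall r, r \in s -> g r = 0) ->
  exists j, forall r, r \in m -> g r = r *: j.

Lemma in_seqM_killed (v : J) : in_seqM s v -> v = 0.
Proof. by move=> [w ->]; rewrite big1 // => i _; rewrite sJ ?mem_nth. Qed.

(** Baer's argument on graphs G of partial maps F -> J that extend phi and vanish on sF. If the
    domain is not F, [socle_mod] gives b outside it with m b inside; [J_inj] turns a |-> G (a b) on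
    m into a value j for b. *)
Lemma extend_mod (K F : lmodType R) (i : {linear K -> F}) (phi : {linear K -> J}) :
  (forall u, in_seqM s (i u) -> in_seqM s u) ->
  exists psi : {linear F -> J}, forall u, psi (i u) = phi u.
Proof.
move=> iref.
pose P (G : set (F * J)) := submod_set (V := (F * J)%type) G /\
  forall j, G (0, j) -> j = 0.
pose G0 : set (F * J) :=
  [set z | exists u w, [/\ in_seqM s w, z.1 = i u + w & z.2 = phi u]].
have PG0 : P G0.
  split; first split.
  - by exists 0, 0; rewrite !linear0 addr0; split=> //; apply: in_seqM0.
  - move=> a [_ _] [_ _] [u [w [sw /= -> ->]]] [u' [w' [sw' /= -> ->]]].
    exists (a *: u + u'), (a *: w + w'); rewrite !linearP /=; split=> //.
      exact: in_seqMP.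
    by rewrite scalerDr addrACA.
  - move=> j [u [w [sw /= /esym/eqP]]]; rewrite addr_eq0 => /eqP iu ->.
    apply: in_seqM_killed; apply: in_seqM_map; apply: iref.
    by rewrite iu -scaleN1r; apply: in_seqMZ.
have [|G [G0G [[G00 GP] Gfun] Gmax]] := @zorn_above _ P G0 PG0.
  move=> C [X0 CX0] CP Ctot; split; first split.
  - by exists X0 => //; have [[]] := CP _ CX0.
  - move=> a u v [X CX Xu] [Y CY Yv].
    have [XY|YX] := Ctot X Y CX CY.
      exists Y => //; have [[_ YP] _] := CP _ CY; apply: YP => //; exact: XY.
    exists X => //; have [[_ XP] _] := CP _ CX; apply: XP => //; exact: YX.
  - by move=> j [X /CP [_ Xfun]] /Xfun.
have GE f j j' : G (f, j) -> G (f, j') -> j = j'.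
  move=> Gj Gj'; apply/eqP; rewrite -subr_eq0; apply/eqP/Gfun.
  have := GP (-1) _ _ Gj' Gj.
  by rewrite -[X in G X]/(_, _) /= !scaleN1r addNr addrC.
have G0s w : in_seqM s w -> G (w, 0).
  by move=> sw; apply: G0G; exists 0, w; rewrite !linear0 add0r.
have Gtot f : exists j, G (f, j).
  apply: contrapT => fA; pose A f := exists j, G (f, j).
  have Asub : submod_set A.
    split; first by exists 0.
    by move=> a u v [j Gu] [j' Gv]; exists (a *: j + j'); apply: (GP a _ _ Gu Gv).
  have [|r [bA mb]] := @socle_mod R m R_noetherian F A f Asub fA.
    move=> a /s_primary [n an]; exists n, 0; apply: G0s.
    exact: in_seqM_scale.
  set b := r *: f in bA mb.
  have [g gE] : exists g : R -> J, forall a, a \in m -> G (a *: b, g a).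
    have /choice [g gE] a : exists j, a \in m -> G (a *: b, j).
      have [am|] := boolP (a \in m); last by exists 0.
      by have [j Gj] := mb a am; exists j.
    by exists g.
  have [||j jE] := J_inj (g := g).
  - move=> a t t' tm tm'; apply: (GE ((a * t + t') *: b)).
      by apply: gE; apply: rpredD => //; apply: idealMr.
    by rewrite scalerDl -scalerA; apply: (GP a _ _ (gE _ tm) (gE _ tm')).
  - move=> y ys; have [ym|ym] := boolP (y \in m).
      by apply: GE (gE _ ym) (G0s _ _); apply: in_seqM_mem.
    case: bA; exists 0; have [u uy] := local_unit R_local ym.
    rewrite -[b]scale1r -uy -scalerA; apply: G0s.
    by apply: in_seqMZ; apply: in_seqM_mem.
  pose G' : set (F * J) := [set z | exists f k t, [/\ G (f, k),
    z.1 = f + t *: b & z.2 = k + t *: j]].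
  have GG' : G `<=` G'.
    by move=> [f' k] Gf; exists f', k, 0; rewrite !scale0r !addr0.
  apply: (bA); exists j; apply: (Gmax G' GG'); last first.
    by exists 0, 0, 1; rewrite !scale1r !add0r.
  split; first split; first exact: GG'.
  - move=> a [_ _] [_ _] [f1 [k1 [t1 [Gf1 /= -> ->]]]] [f2 [k2 [t2 [Gf2 /= -> ->]]]].
    exists (a *: f1 + f2), (a *: k1 + k2), (a * t1 + t2).
    split; first exact: (GP a _ _ Gf1 Gf2).
      by rewrite /= scalerDr scalerDl -scalerA addrACA.
    by rewrite /= scalerDr scalerDl -scalerA addrACA.
  - move=> j' [f1 [k [t [Gf /= /esym/eqP f1E ->]]]].
    (* Here f1 = - t b. For t in m, G already sends t b to t j; otherwise t is a unit and b would
       lie in the domain of G. *)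
    have [tm|tm] := boolP (t \in m).
      apply: Gfun; rewrite (_ : (0, _) = 1 *: (f1, k) + (t *: b, t *: j)).
        by apply: GP => //; rewrite -jE //; apply: gE.
      by rewrite scale1r -[RHS]/(_, _) /= (eqP f1E).
    case: bA; have [u ut] := local_unit R_local tm.
    exists (- u *: k + 0); rewrite -[b]scale1r -ut -scalerA.
    have -> : t *: b = - f1 by apply/eqP; rewrite -addr_eq0 addrC.
    by rewrite scalerN -scaleNr -[_ *: f1]addr0; apply: (GP (- u) (f1, k) 0).
have [|||psi psiE] := @linear_of_rel R F J (fun f j => G (f, j)) => //.
  by move=> a u v u' v'; apply: (GP a (u, v) (u', v')).
exists psi => u; apply: GE (psiE _) _; apply: G0G.
by exists u, 0; rewrite addr0; split=> //; apply: in_seqM0.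
Qed.

End Extension.

(** * Power series in x and lifting of Ext^1 vanishing *)

Section Completeness.
Variables (R : comNzRingType) (m : idealr R).
Hypothesis R_local : local_ring m.
Hypothesis R_noetherian : noetherian R.
Hypothesis R_complete : adically_complete m.
Variable x : R.
Hypothesis xm : x \in m.

Lemma ideal_powS n y : ideal_pow m n y -> ideal_pow m n.+1 (x * y).
Proof.
move=> ny; exists [:: (x, y)]; rewrite big_seq1; split=> // p.
by rewrite inE => /eqP ->.
Qed.

Lemma ideal_powX n y : ideal_pow m n (x ^+ n * y).
Proof.
elim: n y => [//|n IHn] y; rewrite exprS -mulrA.
by apply: ideal_powS; apply: IHn.
Qed.

(** L c is the limit of the partial sums of x^k c_k; uniqueness of limits makes the recursion an
    exact equation. *)
Lemma power_series_sum : exists L : (nat -> R) -> R,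
  forall c, L c = c 0%N + x * L (fun n => c n.+1).
Proof.
pose u (c : nat -> R) n := \sum_(k < n) x ^+ k * c k.
have uS c n : u c n.+1 = c 0%N + x * u (fun k => c k.+1) n.
  rewrite /u big_ord_recl expr0 mul1r mulr_sumr; congr (_ + _).
  by apply: eq_bigr => k _; rewrite exprS mulrA.
have lim c : exists! y, forall n, ideal_pow m n (y - u c n).
  apply: R_complete => n; rewrite /u big_ord_recr /= addrAC subrr add0r.
  exact: ideal_powX.
have /choice [L LE] c : exists y, forall n, ideal_pow m n (y - u c n).
  by have [y [yE _]] := lim c; exists y.
exists L => c; have [y [_ yuniq]] := lim c.
rewrite -(yuniq _ (LE c)); apply: yuniq => -[//|n].
rewrite uS opprD addrACA subrr add0r -mulrBr.
exact/ideal_powS/LE.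
Qed.

Variable Q : lmodType R.
Hypothesis Q_fin_gen : fin_gen Q.
Hypothesis xinj : injective (mulm x Q).

(** A series in Q is encoded by its tails: t n stands for the sum of the x^k q_(n+k), computed on
    coefficients. *)
Lemma mod_series_sum (q : nat -> Q) :
  exists t : nat -> Q, forall n, t n = q n + x *: t n.+1.
Proof.
have [L LE] := power_series_sum; have [gs gsP] := Q_fin_gen.
have [c cE] := choice (fun n => gsP (q n)).
exists (fun n => \sum_(i < size gs) L (fun k => c (n + k)%N i) *: gs`_i) => n.
rewrite scaler_sumr [in RHS]cE -big_split; apply: eq_bigr => i _ /=.
rewrite scalerA -scalerDl LE addn0; congr ((_ + _ * L _) *: _).
by apply/funext => k; rewrite addSnnS.
Qed.

(** The initial terms of such sequences form a submodule W with W = xW. *)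
Lemma mod_separated (t : nat -> Q) : (forall n, t n = x *: t n.+1) -> t 0%N = 0.
Proof.
move=> tE; pose W v := exists2 t : nat -> Q, t 0%N = v & forall n, t n = x *: t n.+1.
apply: (nakayama R_local (fin_gen_noetherian R_noetherian Q_fin_gen) xm (W := W)).
- split; first by exists (fun=> 0) => // n; rewrite scaler0.
  move=> a _ _ [u <- uE] [v <- vE]; exists (fun n => a *: u n + v n) => // n.
  by rewrite uE vE scalerDr !scalerA mulrC.
- move=> _ [u <- uE]; exists (u 1%N); split; last exact: uE.
  by exists (fun n => u n.+1).
- by exists t.
Qed.

Lemma mod_series_unique (q t t' : nat -> Q) :
  (forall n, t n = q n + x *: t n.+1) -> (forall n, t' n = q n + x *: t' n.+1) ->
  t 0%N = t' 0%N.
Proof.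
move=> tE t'E; apply/eqP; rewrite -subr_eq0; apply/eqP.
apply: (@mod_separated (fun n => t n - t' n)) => n.
by rewrite {1}tE {1}t'E opprD addrACA subrr add0r scalerBr.
Qed.

(* Writing phi 0 = psi 0 o incl + x phi 1, phi 1 = psi 1 o incl + x phi 2, and so
   on, the series psi 0 + x psi 1 + x^2 psi 2 + ... extends phi 0. *)
Lemma ext1_complete (M : lmodType R) :
  ext1_vanish M (modm x Q) -> ext1_vanish M Q.
Proof.
move=> EM phi0.
have step (phi : {linear syz M 1 -> Q}) :
    exists p : {linear res M 0 -> Q} * {linear syz M 1 -> Q},
    forall u, phi u = p.1 (incl M u) + x *: p.2 u.
  have [psi psiE] := EM (quom x Q \o phi).
  have [h hE] := res_lift (fun w => quom_surj (psi w)).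
  have [|phi' phi'E] := @factor_inj _ _ _ _ (mulm x Q) (phi \- (h \o incl M)) xinj.
    by move=> u; apply/quom_eq0; rewrite linearB /= hE psiE subrr.
  by exists (h, phi') => u; rewrite -mulmE phi'E /= addrC subrK.
have [next nextE] := choice step.
pose ph n : {linear syz M 1 -> Q} := iter n (fun phi => (next phi).2) phi0.
pose psi n := (next (ph n)).1.
have phE n u : ph n u = psi n (incl M u) + x *: ph n.+1 u by exact: nextE.
have [|||T TE] := @linear_of_rel R (res M 0) Q (fun w v =>
  exists2 t : nat -> Q, t 0%N = v & forall n, t n = psi n w + x *: t n.+1).
- by move=> w; have [t tE] := mod_series_sum (fun n => psi n w); exists (t 0%N), t.
- by move=> w v v' [t <- tE] [t' <- t'E]; apply: mod_series_unique tE t'E.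
- move=> a w v w' v' [t <- tE] [t' <- t'E].
  exists (fun n => a *: t n + t' n) => // n; rewrite linearP {1}tE {1}t'E.
  by rewrite !scalerDr !scalerA (mulrC a x) addrACA.
(* At [incl M u] the values [ph n u] are tails of the same series, so the sum is [phi0 u]. *)
exists T => u; have [t <- tE] := TE (incl M u).
exact: (mod_series_unique tE (phE^~ u)).
Qed.

End Completeness.

(** * Depth of Hom (M, Omega) and injectivity of Omega *)

Section Duality.
Variables (R : comNzRingType) (m : idealr R).
Hypothesis R_local : local_ring m.
Hypothesis R_noetherian : noetherian R.
Hypothesis R_complete : adically_complete m.
Variable M : lmodType R.

Lemma fin_gen_modm x (Q : lmodType R) : fin_gen Q -> fin_gen (modm x Q).
Proof. by apply: fin_gen_surj; apply: quom_surj. Qed.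

Lemma ext1_tower (s : seq R) (Q : lmodType R) : {subset s <= m} -> fin_gen Q ->
  weakly_regular Q s -> ext1_vanish M (quot_seq Q s) -> ext1_vanish M Q.
Proof.
elim: s Q => //= x s IHs Q sm fgQ [xinj reg] EM.
apply: (ext1_complete R_local R_noetherian R_complete _ fgQ xinj).
  by apply: sm; rewrite mem_head.
apply: IHs => //; last exact: fin_gen_modm.
by move=> y ys; apply: sm; rewrite inE ys orbT.
Qed.

(** Thus Hom (M, Q) modulo x is Hom (M, Q/xQ), which lets the induction in [hom_depth] pass to
    Q/xQ. *)
Lemma hom_mod_exact x (Q : lmodType R) : injective (mulm x Q) -> ext1_vanish M Q ->
  exists g : {linear HomMod M Q -> HomMod M (modm x Q)},
    short_exact (mulm x (HomMod M Q)) g.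
Proof.
move=> xinj EM.
pose post (f : HomMod M Q) : HomMod M (modm x Q) := quom x Q \o f.
have plin : linear post by move=> a f h; apply: HomP => u; rewrite /= linearP.
have [g gE] := linear_of_fun plin.
exists g; split.
- move=> f h fh; apply: HomP => u; apply: xinj.
  exact: (congr1 (fun h : HomMod _ _ => h u) fh).
- move=> f; rewrite gE; split=> [f0|[h ->]]; last first.
    by apply: HomP => u; apply/quom_eq0; exists (h u).
  have [|h hE] := @factor_inj _ _ _ _ (mulm x Q) f xinj.
    move=> u; apply/quom_eq0.
    exact: (congr1 (fun h : HomMod _ _ => h u) f0).
  by exists h; apply: HomP => u; rewrite -hE.
- move=> h; have [f fE] := ext1_lift (modm_exact xinj) h EM.
  by exists f; rewrite gE; apply: HomP => u; rewrite -fE.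
Qed.

Lemma hom_depth (s : seq R) (Q : lmodType R) : {subset s <= m} -> fin_gen Q ->
  weakly_regular Q s -> ext1_vanish M (quot_seq Q s) ->
  forall i, (i < size s)%N -> ext_vanish i (residue m) (HomMod M Q).
Proof.
elim: s Q => //= x s IHs Q sm fgQ [xinj reg] EM i.
have EQ : ext1_vanish M Q by apply: (@ext1_tower (x :: s)).
have [g ses] := hom_mod_exact xinj EQ.
have xk : forall v : residue m, x *: v = 0.
  by apply: residue_killed; apply: sm; rewrite mem_head.
case: i => [_|i si]; first by apply: (ext_vanish0_inj xk); case: ses.
apply: (ext_vanish_mod xk ses); apply: IHs => //; last exact: fin_gen_modm.
by move=> y ys; apply: sm; rewrite inE ys orbT.
Qed.

End Duality.

(** M is the pushout of L and [res N 0] along [syz N 1], so phi glues with an extension psi of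
    [phi \o k]. *)
Lemma ext1_injective (R : comNzRingType) (L M N Q : lmodType R)
    (f : {linear L -> M}) (g : {linear M -> N}) :
  short_exact f g -> ext1_vanish N Q ->
  forall phi : {linear L -> Q}, exists psi : {linear M -> Q},
    forall u, psi (f u) = phi u.
Proof.
move=> [finj exfg gsurj] EN phi.
have [h hE] := res_lift (fun w => gsurj (aug N w)).
have [|k kE] := @factor_inj _ _ _ _ f (h \o incl N) finj.
  by move=> u; apply/exfg; rewrite /= hE aug_incl.
have [psi psiE] := EN (phi \o k).
pose G v q := exists u w, v = f u + h w /\ q = phi u + psi w.
have Gfun v q q' : G v q -> G v q' -> q = q'.
  move=> [u [w [vE ->]]] [u' [w' [vE' ->]]].
  have gf z : g (f z) = 0 by apply/exfg; exists z.
  have /aug_ker [z zE] : aug N (w - w') = 0.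
    rewrite linearB -!hE; have := congr1 g vE.
    by rewrite vE' !linearD !gf !add0r => ->; rewrite subrr.
  have uz : u' - u = k z.
    apply: finj; rewrite kE /= -zE !linearB; apply/eqP.
    by rewrite subr_eq addrAC eq_sym subr_eq addrC -vE vE' addrC.
  apply/eqP; rewrite -subr_eq0 opprD addrACA -!linearB /= zE psiE /= -uz.
  by rewrite -linearD addrC subrKA subrr linear0.
have [|||theta thetaE] := @linear_of_rel R M Q G => //.
- move=> v; have [w wE] := aug_onto (g v).
  have /exfg [u uE] : g (v - h w) = 0 by rewrite linearB hE wE subrr.
  by exists (phi u + psi w), u, w; rewrite -uE subrK.
- move=> a v q v' q' [u [w [-> ->]]] [u' [w' [-> ->]]].
  exists (a *: u + u'), (a *: w + w'); split; rewrite scalerDr addrACA.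
    by congr (_ + _); rewrite linearP.
  by congr (_ + _); rewrite linearP.
exists theta => u; apply: (Gfun _ _ _ (thetaE _)).
by exists u, 0; rewrite !linear0 !addr0.
Qed.

Theorem proposition3p10 (R : comNzRingType) (m : idealr R) (d : nat)
    (Omega : lmodType R)
    (R_noetherian : noetherian R)
    (R_local : local_ring m)
    (R_complete : adically_complete m)
    (R_dim : krull_dim R d)
    (R_CM : CM_ring m d)
    (Omega_canonical : canonical_module m d Omega) :
  (forall M : lmodType R, CohCM m d M -> CohCM m d (HomMod M Omega)) /\
  injective_object (CohCM m d) Omega.
Proof.
have [[s0 [s0m s0reg s0d]] _] := R_CM.
have [[fgO _] Odim] := Omega_canonical.
have OE i : i != d -> ext_vanish i (residue m) Omega.
  move=> /negbTE id; apply/ext_vanishE => z.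
  (* For i other than d the basis is indexed by ['I_0], so z is an empty sum. *)
  have [_ [e eP]] := Odim i; have [c [-> _]] := eP z.
  by move: c e {eP}; rewrite id => c e; rewrite big_ord0.
have s0prim := regular_primary R_local R_dim s0reg s0d.
(* Regularity on Omega is obtained for the reversed sequence, which generates the same ideal. *)
pose s := rev s0.
have sm : {subset s <= m} by move=> x; rewrite mem_rev => /s0m.
have sd : size s = d by rewrite size_rev.
have sprim a : a \in m -> exists n, in_seqM s (a ^+ n : R^o).
  move=> /s0prim [n an]; exists n; apply: in_seqM_sub an => x.
  by rewrite mem_rev.
have reg : weakly_regular Omega s.
  apply: (koszul_weakly_regular R_local R_noetherian fgO s0m) => n; rewrite s0d.
  apply: (koszul_exact R_noetherian s0prim) => i id.
  by apply: OE; rewrite ltn_eqF.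
have EJ M : CohCM m d M -> ext1_vanish M (quot_seq Omega s).
  move=> MC phi; apply: (extend_mod R_local R_noetherian sprim).
  - exact: quot_seq_killed.
  - move=> g; apply: residue_inj => //.
    by apply: OE; rewrite sd gtn_eqF.
  have ses : short_exact (incl M) (aug M).
    split; [exact: incl_inj| |exact: aug_onto].
    by move=> w; split=> [/aug_ker//|[u ->]]; rewrite aug_incl.
  apply: (koszul_reflects ses) => s_gt0.
  apply: (koszul_exact R_noetherian sprim (d := d)).
    by move=> i id; apply/ext_vanishE; apply: MC.
  by rewrite -sd prednK.
split=> [M MC i id|].
  apply/ext_vanishE; apply: (@hom_depth _ _ R_local R_noetherian R_complete _ s) => //.
    exact: EJ.
  by rewrite sd.
split=> [i id|L M N f g _ _ NC ses phi].
  by apply/ext_vanishE/OE; rewrite ltn_eqF.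
have EN : ext1_vanish N Omega.
  apply: (ext1_tower R_local R_noetherian R_complete sm fgO reg); exact: EJ.
have [psi psiE] := ext1_injective ses EN phi.
by exists psi; apply: HomP => u; rewrite -psiE.
Qed.
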